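(* Let $d\ge2$, and for $\alpha,\beta\ge0$ let $F_{\alpha,\beta}(t)=t^{d-1}(\log\frac1t)^{-\beta}(\log\log\frac1t)^{-\alpha}$, $t\in(0,e^{-3}]$. Let $E\subset\mathbb R^d$ be a compact subset. Then the following assertions are true. (i) If $C_{F^{-1}_{\alpha,\beta}}(E)>0$, then $c_{F_{\alpha,\beta}}(E)\ge\frac12C_{F^{-1}_{\alpha,\beta}}(E)>0$. (ii) Let $\varepsilon>0$. If $c_{F_{\alpha,\beta}}(E)>0$ for some $\beta\ge1$ and $\alpha\ge1+\varepsilon$, then there exists a constant $A>0$, depending only on $d,\alpha,\beta,\varepsilon$ and the diameter $d(E)$, such that $$C_{F^{-1}_{\alpha-1-\varepsilon,\beta-1}}(E)\ge A\,c_{F_{\alpha,\beta}}(E)>0 .$$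
   Context: A gauge function is a strictly increasing continuous $f:(0,\infty)\to[0,\infty)$ with $\lim_{t\to0^+}f(t)=0$. For a gauge function $f$, the $f$-Hausdorff content of $E\subset\mathbb R^d$ is $c_f(E)=\inf\{\sum_{j\ge1} f(d(B_j)):E\subset\bigcup_{j\ge1} B_j\}$, where the $B_j$ are open balls in $\mathbb R^d$ with diameter $d(B_j)$. Each $F_{\alpha,\beta}$ is understood as a gauge function on $(0,\infty)$ via a fixed extension with $F_{\alpha,\beta}(t)\sim1$ as $t\to+\infty$. $f^{-1}$ denotes $1/f$, and $C_{f^{-1}}$ is the capacity with kernel $1/f(|x-y|)$ (equal to $+\infty$ if $x=y$): for a bounded Borel set $E$, $$C_{f^{-1}}(E)=\sup\Big\{\Big(\int\!\!\int\frac{d\mu(x)\,d\mu(y)}{f(|x-y|)}\Big)^{-1}:\ \mu\text{ a Radon measure on }\mathbb R^d,\ \mathrm{supp}\,\mu\subset E,\ \mu(\mathbb R^d)=1\Big\},$$ with $1/\infty=0$ and $C_{f^{-1}}(\emptyset)=0$. *)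

(* Defs.v *)
From HB Require Import structures.
From mathcomp Require Import all_boot all_order all_algebra.
From mathcomp Require Import all_classical all_reals all_analysis.

Set Implicit Arguments.
Unset Strict Implicit.
Unset Printing Implicit Defensive.

Import Order.TTheory GRing.Theory Num.Theory.
Import numFieldNormedType.Exports.

Local Open Scope classical_set_scope.
Local Open Scope ring_scope.

(* The library's norm `|x| on 'rV[R]_d is the sup norm, so the Euclidean norm
   is defined here; the topologies of the two norms coincide, and [open] and
   [compact] are the library's notions. *)
Definition enorm (R : realType) (d : nat) (x : 'rV[R]_d) : R :=
  Num.sqrt (\sum_(i < d) x 0 i ^+ 2).

(* [sup] is 0 on the empty set and on sets that are unbounded above. *)
Definition ediam (R : realType) (d : nat) (A : set 'rV[R]_d) : R :=
  sup [set r | exists x y, [/\ A x, A y & r = enorm (x - y)]].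

Definition eball (R : realType) (d : nat) (x : 'rV[R]_d) (r : R)
  : set 'rV[R]_d := [set y | enorm (y - x) < r].

Definition is_open_ball (R : realType) (d : nat) (B : set 'rV[R]_d) : Prop :=
  exists x r, 0 < r /\ B = eball x r.

(* A function on (0, oo) is represented by a total function R -> R; its values
   outside (0, oo) are never used. *)
Definition gauge_function (R : realType) (f : R -> R) : Prop :=
  [/\ forall t : R, 0 < t -> 0 <= f t,
      forall s t : R, 0 < s -> s < t -> f s < f t,
      forall t : R, 0 < t -> {for t, continuous f}
    & f t @[t --> 0^'+] --> 0].

Definition hcontent (R : realType) (d : nat) (f : R -> R) (E : set 'rV[R]_d)
  : \bar R :=
  ereal_inf [set s | exists B : nat -> set 'rV[R]_d,
    [/\ forall j, is_open_ball (B j), E `<=` \bigcup_j B j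
      & s = (\sum_(0 <= j <oo) (f (ediam (B j)))%:E)%E]].

(* R^d with its Borel sigma-algebra. *)
Notation borelRd R d := (g_sigma_algebraType (@open 'rV[R%type]_d)).

Definition radon_measure (R : realType) (d : nat)
    (mu : {measure set (borelRd R d) -> \bar R}) : Prop :=
  (forall K : set 'rV[R]_d, compact K -> (mu K < +oo)%E) /\
  (forall A : set (borelRd R d), measurable A ->
     mu A = ereal_sup
       [set mu K | K in [set K : set 'rV[R]_d | compact K /\ K `<=` A]]).

Definition measure_supp (R : realType) (d : nat)
    (mu : {measure set (borelRd R d) -> \bar R}) : set 'rV[R]_d :=
  [set x | forall U : set 'rV[R]_d, open U -> U x -> (0 < mu U)%E].

Definition inv_kernel (R : realType) (d : nat) (f : R -> R) (x y : 'rV[R]_d)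
  : \bar R :=
  if x == y then +oo%E else ((f (enorm (x - y)))^-1)%:E.

Definition energy (R : realType) (d : nat) (f : R -> R)
    (mu : {measure set (borelRd R d) -> \bar R}) : \bar R :=
  (\int[mu]_x \int[mu]_y inv_kernel f x y)%E.

(* The capacity C_{f^{-1}}. In \bar R, (+oo)^-1 = 0. The case E = set0 is set
   apart because [ereal_sup set0] is -oo. *)
Definition inv_capacity (R : realType) (d : nat) (f : R -> R)
    (E : set 'rV[R]_d) : \bar R :=
  if `[< E = set0 >] then 0%E else
  ereal_sup [set c | exists mu : {measure set (borelRd R d) -> \bar R},
    [/\ radon_measure mu, measure_supp mu `<=` E, mu setT = 1%E
      & c = ((energy f mu)^-1)%E]].

Definition F_small (R : realType) (d : nat) (alpha beta t : R) : R :=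
  t ^+ d.-1 * ln t^-1 `^ (- beta) * ln (ln t^-1) `^ (- alpha).

(* The last clause is F(t) ~ 1 as t -> +oo, that is, F is bounded above and
   away from 0 near +oo; in particular it holds if F tends to 1. *)
Definition gauge_extension (R : realType) (d : nat) (alpha beta : R)
    (F : R -> R) : Prop :=
  [/\ gauge_function F,
      forall t : R, 0 < t -> t <= expR (- 3) -> F t = F_small d alpha beta t
    & exists c C : R, 0 < c /\ \forall t \near +oo, c <= F t <= C].

(* Main.v *)
(* (i) Let balls B_j cover E and split E into disjoint pieces A_j of the B_j. On
   A_j x A_j the kernel is at least 1 / f(d(B_j)), so the energy I of mu is at
   least the sum of mu(A_j)^2 / f(d(B_j)), and Cauchy-Schwarz gives
   1 <= I * sum_j f(d(B_j)).

   (ii) Number the dyadic cubes of each generation so that nested cubes have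
   nested N-adic intervals in ]0, 1], with N = 2^d, and let G(t) be the
   f-content of the part of E in the cubes whose interval ends before t. The
   Stieltjes measure of G, pushed forward by the map decoding N-adic expansions
   into points, is a Frostman measure: its mass is the content of E, and a cube
   of side s has mass at most f(C s) because the content is subadditive. Put
   f = F_{alpha,beta} and g = F_{alpha-1-eps,beta-1}. Cutting R^d into dyadic
   annuli bounds the potential of this measure by the sum over n of
   f(C 2^-n) / g(2^-n), whose terms are of order 1 / (n (log n)^(1+eps)). *)
Require Import Defs.
From HB Require Import structures.
From mathcomp Require Import all_boot all_order all_algebra finmap.
From mathcomp Require Import all_classical all_reals all_analysis.
From mathcomp Require Import measurable_realfun ring lra.

Set Implicit Arguments.
Unset Strict Implicit.
Unset Printing Implicit Defensive.

Import Order.TTheory GRing.Theory Num.Theory.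
Import numFieldNormedType.Exports.

Local Open Scope classical_set_scope.
Local Open Scope ring_scope.

(** * The Euclidean norm and balls *)

(** The integral of a nonnegative function is the supremum of the integrals of the simple functions
    below it, and a larger function has more of them. Kernels and potentials can thus be compared
    without discussing their measurability. *)
Lemma ge0_le_integralT d (T : measurableType d) (R : realType)
    (mu : {measure set T -> \bar R}) (f g : T -> \bar R) :
  (forall x, 0 <= f x)%E -> (forall x, f x <= g x)%E ->
  (\int[mu]_x f x <= \int[mu]_x g x)%E.
Proof.
move=> f0 fg; have g0 x : (0 <= g x)%E by apply: le_trans (fg x).
rewrite !ge0_integralTE//; apply: ge_ereal_sup => _ [h hf <-].
by apply: ereal_sup_ubound; exists h => // x; apply: le_trans (hf x) (fg x).
Qed.

Lemma enorm_ge0 (R : realType) d (x : 'rV[R]_d) : 0 <= enorm x.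
Proof. exact: sqrtr_ge0. Qed.

Lemma enormB (R : realType) d (x y : 'rV[R]_d) : enorm (x - y) = enorm (y - x).
Proof.
rewrite /enorm; congr Num.sqrt; apply: eq_bigr => i _.
by rewrite -sqrrN !mxE opprB.
Qed.

Lemma coord_le_enorm (R : realType) d (x : 'rV[R]_d) i : `|x 0 i| <= enorm x.
Proof.
rewrite -sqrtr_sqr ler_wsqrtr// (bigD1 i)//= lerDl sumr_ge0// => j _.
exact: sqr_ge0.
Qed.

Lemma enorm_le (R : realType) d (x : 'rV[R]_d) r :
  0 <= r -> (forall i, `|x 0 i| <= r) -> enorm x <= d%:R * r.
Proof.
move=> r0 xr; rewrite -(ger0_norm (mulr_ge0 (ler0n _ d) r0)) -sqrtr_sqr ler_wsqrtr//.
have h : \sum_(i < d) x 0 i ^+ 2 <= \sum_(i < d) r ^+ 2.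
  by apply: ler_sum => i _; rewrite -real_normK ?num_real// lerXn2r ?nnegrE.
apply: le_trans h _; rewrite sumr_const card_ord -[X in X <= _]mulr_natl exprMn.
rewrite ler_wpM2r ?sqr_ge0// -natrX ler_nat.
by case: d x xr => // n _ _; rewrite expnS expn1 leq_pmull.
Qed.

Lemma norm_le_enorm (R : realType) d (x : 'rV[R]_d) : `|x| <= enorm x.
Proof.
have [->|x0] := eqVneq `|x| 0; first exact: enorm_ge0.
have [[i j] xij] := mx_norm_neq0 x0.
by rewrite [X in X <= _]xij (ord1 i) coord_le_enorm.
Qed.

Lemma coord_le_norm (R : realType) d (x : 'rV[R]_d) i : `|x 0 i| <= `|x|.
Proof.
rewrite [X in _ <= X]mx_normrE.
exact: (le_bigmax _ (fun ij : 'I_1 * 'I_d => `|x ij.1 ij.2|) (ord0, i)).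
Qed.

Lemma enorm_le_norm (R : realType) d (x : 'rV[R]_d) : enorm x <= d%:R * `|x|.
Proof. by apply: enorm_le => // i; exact: coord_le_norm. Qed.

Lemma enorm_gt0 (R : realType) d (x : 'rV[R]_d) : x != 0 -> 0 < enorm x.
Proof. by move=> x0; apply: lt_le_trans (norm_le_enorm x); rewrite normr_gt0. Qed.

Lemma enorm0 (R : realType) d : enorm (0 : 'rV[R]_d) = 0.
Proof. by apply: le_anti; rewrite enorm_ge0 (le_trans (enorm_le_norm _))// normr0 mulr0. Qed.

Lemma continuous_enorm (R : realType) d : continuous (@enorm R d).
Proof.
move=> x; apply: (@continuous_comp _ _ _ (fun x : 'rV[R]_d => \sum_(i < d) x 0 i ^+ 2)); last first.
  exact: sqrt_continuous.
apply: continuous_big => [|i _ {}x]; first exact: (@pseudometric_normed_Zmodule.add_continuous _ R).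
apply: (@continuous_comp _ _ _ (fun y : 'rV[R]_d => y 0 i) (fun z : R => z ^+ 2)).
  exact: coord_continuous.
exact: exprn_continuous.
Qed.

Lemma open_eball (R : realType) d (x : 'rV[R]_d) r : open (eball x r).
Proof.
rewrite (_ : eball x r = (fun y => enorm (y - x)) @^-1` [set z | z < r])//.
apply: open_comp; last exact: open_lt.
move=> y _.
have h : {for y, continuous (fun y : 'rV[R]_d => y - x)}.
  by apply: (@continuousB _ _ _ id (cst x) y); [exact: cvg_id|exact: cst_continuous].
have k : {for (y - x), continuous (@enorm R d)} by exact: continuous_enorm.
exact: (continuous_comp h k).
Qed.

(** The bound [M] makes the set of distances bounded above, so that [ediam] is a true supremum and
    not the default value 0. *)
Lemma le_ediam_norm (R : realType) d (A : set 'rV[R]_d) M x y :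
  (forall z, A z -> `|z| <= M) -> A x -> A y -> enorm (x - y) <= ediam A.
Proof.
move=> AM Ax Ay; apply: ub_le_sup; last by exists x, y.
exists (d%:R * (M + M)) => _ [u [v [Au Av ->]]].
apply: le_trans (enorm_le_norm _) _; rewrite ler_wpM2l//.
by rewrite (le_trans (ler_normB _ _))// lerD ?AM.
Qed.

Lemma eball_bounded (R : realType) d (x : 'rV[R]_d) r z :
  eball x r z -> `|z| <= r + `|x|.
Proof.
move=> zr; rewrite -[z](subrK x) (le_trans (ler_normD _ _))// lerD2r.
by rewrite (le_trans (norm_le_enorm _))// ltW.
Qed.

Lemma le_ediam_eball (R : realType) d (c x y : 'rV[R]_d) r :
  eball c r x -> eball c r y -> enorm (x - y) <= ediam (eball c r).
Proof. by apply: le_ediam_norm => z; exact: eball_bounded. Qed.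

Lemma ediam_eball_le (R : realType) d (c : 'rV[R]_d) r :
  0 < r -> ediam (eball c r) <= d%:R * (r + r).
Proof.
move=> r0; apply: sup_le_ub.
  by exists (enorm (c - c)), c, c; split => //; rewrite /eball/= subrr enorm0.
move=> _ [u [v [ur vr ->]]]; apply: le_trans (enorm_le_norm _) _.
rewrite ler_wpM2l// -[u - v](subrKA c) (le_trans (ler_normD _ _))// lerD//.
  by rewrite (le_trans (norm_le_enorm _))// ltW.
by rewrite (le_trans (norm_le_enorm _))// enormB ltW.
Qed.

Lemma ediam_eball_gt0 (R : realType) d (c : 'rV[R]_d) r :
  (0 < d)%N -> 0 < r -> 0 < ediam (eball c r).
Proof.
(* The vector [e] has norm at most r/2, so the centre and its translate by [e] are two distinct
   points of the ball. *)
move=> d0 r0; pose e : 'rV[R]_d := const_mx (r / (2 * d%:R)).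
have dr : 0 < d%:R :> R by rewrite ltr0n.
have e0 : 0 < r / (2 * d%:R) by rewrite divr_gt0// mulr_gt0.
have ne : enorm e < r.
  apply: (@le_lt_trans _ _ (d%:R * (r / (2 * d%:R)))).
    by apply: enorm_le; [exact: ltW|move=> i; rewrite mxE gtr0_norm].
  rewrite [X in X < _](_ : _ = r / 2); first lra.
  by field; rewrite gt_eqF.
have ce : eball c r (c + e) by rewrite /eball/= addrAC subrr add0r.
have cc : eball c r c by rewrite /eball/= subrr enorm0.
apply: lt_le_trans (le_ediam_eball ce cc); rewrite addrAC subrr add0r.
apply: lt_le_trans (coord_le_enorm e (Ordinal d0)).
by rewrite mxE normr_gt0 gt_eqF.
Qed.

(** * Gauge functions and Borel sets *)

Lemma gauge_gt0 (R : realType) (f : R -> R) t :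
  gauge_function f -> 0 < t -> 0 < f t.
Proof.
move=> [f0 fi _ _] t0; have t2 : 0 < t / 2 by rewrite divr_gt0.
by apply: le_lt_trans (f0 _ t2) (fi _ _ t2 _); lra.
Qed.

Lemma gauge_le (R : realType) (f : R -> R) s t :
  gauge_function f -> 0 < s -> s <= t -> f s <= f t.
Proof.
move=> [_ fi _ _] s0; rewrite le_eqVlt => /predU1P[->//|st].
by rewrite ltW// fi.
Qed.

Lemma measurable_open_borelRd (R : realType) d (U : set 'rV[R]_d) :
  open U -> measurable (U : set (borelRd R d)).
Proof. by move=> oU; apply: sub_sigma_algebra. Qed.

Lemma measurable_closed_borelRd (R : realType) d (U : set 'rV[R]_d) :
  closed U -> measurable (U : set (borelRd R d)).
Proof.
move=> cU; rewrite -(setCK U); apply: measurableC.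
by apply: measurable_open_borelRd; exact: closed_openC.
Qed.

(** * The capacity is at most the content *)

Lemma le_measureS dd (T : measurableType dd) (R : realType)
    (mu : {measure set T -> \bar R}) (A B : set T) :
  measurable A -> measurable B -> A `<=` B -> (mu A <= mu B)%E.
Proof. by move=> mA mB; apply: le_measure; exact: mem_set. Qed.

(** A point outside the support has a null open neighbourhood, so a compact set outside [E] is
    covered by finitely many null open sets; inner regularity passes from these compact sets to the
    whole complement. *)
Lemma radon_supp_null (R : realType) d (E : set 'rV[R]_d)
    (mu : {measure set (borelRd R d) -> \bar R}) :
  radon_measure mu -> closed E -> measure_supp mu `<=` E -> mu (~` E) = 0%E.
Proof.
move=> [_ reg] cE suppE; apply/eqP; rewrite eq_le measure_ge0 andbT.
have mE : measurable (~` E : set (borelRd R d)).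
  by apply: measurable_open_borelRd; exact: closed_openC.
rewrite (reg _ mE); apply: ge_ereal_sup => _ [K [cK KE] <-].
have : cover_compact K by rewrite -compact_cover.
move=> /(_ (set 'rV[R]_d) [set U | open U /\ mu U = 0%E] id) [|x Kx|].
- by move=> U [].
- have /existsNP[U /not_implyP[oU /not_implyP[Ux /negP]]] : ~ measure_supp mu x.
    by move=> /suppE; exact: KE.
  by rewrite -leNgt => U0; exists U => //; split => //; apply/eqP; rewrite eq_le U0 measure_ge0.
move=> D DU KD.
have mK : measurable (K : set (borelRd R d)).
  by apply: measurable_closed_borelRd; apply: compact_closed => //; exact: norm_hausdorff.
have mD (U : set 'rV[R]_d) : U \in D -> measurable (U : set (borelRd R d)).
  by move=> /DU /set_mem [oU _]; exact: measurable_open_borelRd.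
have KD' : (mu K <= \sum_(U \in [set` D]) mu U)%E by exact: content_sub_fsum.
apply: le_trans KD' _.
by rewrite fsbig1// => U /= /DU /set_mem [].
Qed.

Lemma integral_cst_indic dd (T : measurableType dd) (R : realType)
    (mu : {measure set T -> \bar R}) (A : set T) (c : R) :
  measurable A -> 0 <= c ->
  (\int[mu]_x (c * \1_A x)%:E = c%:E * mu A)%E.
Proof.
move=> mA c0; under eq_integral do rewrite EFinM.
rewrite ge0_integralZl_EFin//; last by apply/measurable_EFinP; exact: measurable_indic.
by rewrite integral_indic// setIT.
Qed.

Lemma inv_kernel_ge0 (R : realType) d (f : R -> R) (x y : 'rV[R]_d) :
  gauge_function f -> (0 <= inv_kernel f x y)%E.
Proof.
move=> gf; rewrite /inv_kernel; case: eqP => // /eqP xy.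
by rewrite lee_fin invr_ge0 ltW// gauge_gt0// enorm_gt0// subr_eq0.
Qed.

(** The choice t = 1/i gives 2 <= 1 + s i. The case i = 0 is excluded by t = s + 1, for which s/t <
    1. *)
Lemma inv_le_of_forall_weight (R : realType) (i s : R) :
  0 <= i -> 0 <= s -> (forall t, 0 < t -> 2 <= t * i + s / t) ->
  0 < i /\ i^-1 <= s.
Proof.
rewrite le_eqVlt => /predU1P[<-|i0] s0 key.
  have s1 : 0 < s + 1 by lra.
  by have := key _ s1; rewrite mulr0 add0r ler_pdivlMr//; lra.
split => //; have := key i^-1; rewrite invr_gt0 => /(_ i0).
by rewrite mulVf ?gt_eqF// invrK -[i^-1]mul1r ler_pdivrMr//; lra.
Qed.

Lemma inv_energy_le_cover (R : realType) d (f : R -> R) (E : set 'rV[R]_d)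
    (mu : {measure set (borelRd R d) -> \bar R}) (B : nat -> set 'rV[R]_d) :
  (0 < d)%N -> gauge_function f -> mu (~` E) = 0%E -> mu setT = 1%E ->
  measurable (E : set (borelRd R d)) ->
  (forall j, is_open_ball (B j)) -> E `<=` \bigcup_j B j ->
  ((energy f mu)^-1 <= \sum_(0 <= j <oo) (f (ediam (B j)))%:E)%E.
Proof.
move=> d0 gf muEC mu1 mE ballB EB.
set c := fun j => f (ediam (B j)).
have c0 j : 0 < c j.
  have [x [r [r0 Bj]]] := ballB j.
  by apply: gauge_gt0 => //; rewrite Bj ediam_eball_gt0.
have mB j : measurable (B j : set (borelRd R d)).
  have [x [r [r0 ->]]] := ballB j.
  by apply: measurable_open_borelRd; exact: open_eball.
pose A : nat -> set (borelRd R d) := seqDU B.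
have mA j : measurable (A j) by apply: measurableD => //; exact: bigsetU_measurable.
have tA : trivIset setT A by exact: trivIset_seqDU.
have le1 (X : set (borelRd R d)) : measurable X -> (mu X <= 1)%E.
  by move=> mX; rewrite -mu1; exact: le_measureS.
have finA j : mu (A j) \is a fin_num.
  by rewrite ge0_fin_numE// (le_lt_trans (le1 _ (mA j)))// ltry.
pose a j := fine (mu (A j)).
have a0 j : 0 <= a j by rewrite fine_ge0.
have muA1 : (\sum_(0 <= j <oo) mu (A j) = 1)%E.
  rewrite -measure_semi_bigcup//; last exact: bigcupT_measurable.
  apply/eqP; rewrite eq_le le1/=; last exact: bigcupT_measurable.
  have : (mu setT <= mu (~` E) + mu E)%E.
    by rewrite -(setvU E); apply: measureU2 => //; exact: measurableC.
  rewrite mu1 muEC add0e => /le_trans; apply.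
  apply: le_measureS => //; first exact: bigcupT_measurable.
  by rewrite /A -seqDU_bigcup_eq.
have Agt x y j : A j x -> A j y -> ((c j)^-1%:E <= inv_kernel f x y)%E.
  move=> [Bx _] [By _]; rewrite /inv_kernel; case: eqP => [_|/eqP xy]; first exact: leey.
  have exy : 0 < enorm (x - y) by rewrite enorm_gt0// subr_eq0.
  have leB : enorm (x - y) <= ediam (B j).
    have [z [r [_ Bj]]] := ballB j; move: Bx By; rewrite Bj; exact: le_ediam_eball.
  have fle : f (enorm (x - y)) <= c j by exact: gauge_le.
  by rewrite lee_fin lef_pV2 ?posrE//; exact: gauge_gt0.
have inner x j : A j x -> ((a j / c j)%:E <= \int[mu]_y inv_kernel f x y)%E.
  move=> Ax; rewrite mulrC EFinM fineK//.
  rewrite -integral_cst_indic//; last by rewrite invr_ge0 ltW.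
  apply: ge0_le_integralT => y; first by rewrite lee_fin mulr_ge0// invr_ge0 ltW.
  rewrite indicE; case: (boolP (y \in A j)) => [|_].
    by rewrite inE mulr1; exact: Agt.
  by rewrite mulr0 inv_kernel_ge0.
have Ige n : (\sum_(j < n) (a j ^+ 2 / c j)%:E <= energy f mu)%E.
  (* The potential is bounded below by the step function [h], equal to a_j / c_j on A_j; the A_j are
     disjoint, so at most one term is nonzero at each point. *)
  pose h (x : borelRd R d) := (\sum_(j < n) (a j / c j * \1_(A j) x)%:E)%E.
  apply: (@le_trans _ _ (\int[mu]_x h x)%E).
    rewrite ge0_integral_sum//; last 2 first.
    - move=> j; apply/measurable_EFinP; apply: measurable_funM => //.
    - by move=> j x _; rewrite lee_fin !mulr_ge0// invr_ge0 ltW.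
    apply: lee_sum => j _; rewrite integral_cst_indic//; last by rewrite divr_ge0// ltW.
    by rewrite -[mu (A j)]fineK// -EFinM lee_fin -/(a j) expr2 mulrAC.
  apply: ge0_le_integralT => x.
    by apply: sume_ge0 => j _; rewrite lee_fin mulr_ge0// divr_ge0// ltW.
  have [[j Aj]|nA] := pselect (exists j : 'I_n, A j x).
    rewrite /h (bigD1 j)//= big1 ?adde0.
      by rewrite indicE mem_set// mulr1; exact: inner.
    move=> i ij; rewrite indicE memNset ?mulr0// => Ai.
    have /negP[] := ij; apply/eqP/val_inj.
    by apply: (tA i j) => //; exists x.
  rewrite /h big1 => [|j _]; last first.
    by rewrite indicE memNset ?mulr0// => Aj; apply: nA; exists j.
  by apply: integral_ge0 => y _; exact: inv_kernel_ge0.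
have cE0 (j : nat) : (0 <= (c j)%:E)%E by rewrite lee_fin ltW.
set S := (\sum_(0 <= j <oo) _)%E.
have S0 : (0 <= S)%E by apply: nneseries_ge0 => j _ _; exact: cE0.
have [->|Sfin] := eqVneq S +oo%E; first exact: leey.
have {}Sfin : S \is a fin_num by rewrite ge0_fin_numE// lt_neqAle Sfin leey.
have I0 : (0 <= energy f mu)%E.
  by apply: integral_ge0 => x _; apply: integral_ge0 => y _; exact: inv_kernel_ge0.
have [->|Ifin] := eqVneq (energy f mu) +oo%E; first by rewrite invey.
have {}Ifin : energy f mu \is a fin_num by rewrite ge0_fin_numE// lt_neqAle Ifin leey.
set I := fine (energy f mu).
have {}I0 : 0 <= I by rewrite fine_ge0.
have {}Ige n : \sum_(j < n) (a j ^+ 2 / c j) <= I.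
  by rewrite -lee_fin fineK// -sumEFin.
have Sge n : \sum_(j < n) c j <= fine S.
  rewrite -lee_fin fineK// -sumEFin -(big_mkord predT (fun j => (c j)%:E)).
  by apply: nneseries_lim_ge => j _ _; exact: cE0.
(* AM-GM: [2 a_j <= s a_j^2 / c_j + c_j / s] *)
have key (s : R) : 0 < s -> 2 <= s * I + fine S / s.
  move=> s0; rewrite -lee_fin.
  (* Writing 2 as twice the total mass of the A_j reduces the claim to partial sums. *)
  rewrite (_ : 2%:E = 2%:E * \sum_(0 <= j <oo) mu (A j))%E; last by rewrite muA1 mule1.
  rewrite -lee_pdivlMl//; apply: lime_le; first exact: is_cvg_nneseries.
  apply: nearW => n; rewrite big_mkord; under eq_bigr do rewrite -[mu _]fineK//.
  rewrite sumEFin -EFinM lee_fin -ler_pdivrMl ?invr_gt0// invrK.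
  apply: (@le_trans _ _ (\sum_(j < n) (s * (a j ^+ 2 / c j) + c j / s))).
    rewrite mulr_sumr; apply: ler_sum => j _.
    have := sqr_ge0 (s * a j - c j) => h.
    rewrite -/(a j) -subr_ge0 (_ : _ - _ = (s * a j - c j) ^+ 2 / (s * c j)).
      by rewrite divr_ge0// mulr_ge0// ltW.
    by field; rewrite (gt_eqF s0) (gt_eqF (c0 j)).
  rewrite big_split/= -mulr_sumr -mulr_suml lerD//.
    by apply: ler_wpM2l (Ige n); exact: ltW.
  by apply: ler_wpM2r (Sge n); rewrite invr_ge0 ltW.
have [|i0 iS] := inv_le_of_forall_weight I0 _ key; first by rewrite fine_ge0.
by rewrite -[energy f mu]fineK// -/I -[S]fineK// inver gt_eqF// lee_fin.
Qed.

Lemma inv_capacity_le_hcontent (R : realType) d (f : R -> R) (E : set 'rV[R]_d) :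
  (0 < d)%N -> gauge_function f -> compact E ->
  (inv_capacity f E <= hcontent f E)%E.
Proof.
move=> d0 gf cE; rewrite /inv_capacity; case: asboolP => [_|_].
  apply: le_ereal_inf_tmp => _ [B [ballB _ ->]]; apply: nneseries_ge0 => j _ _.
  have [x [r [r0 ->]]] := ballB j.
  by rewrite lee_fin ltW// gauge_gt0// ediam_eball_gt0.
have clE : closed E by apply: compact_closed => //; exact: norm_hausdorff.
apply: ge_ereal_sup => _ [mu [rad supp mu1 ->]].
apply: le_ereal_inf_tmp => _ [B [ballB EB ->]].
apply: (@inv_energy_le_cover _ _ _ E) => //.
  exact: radon_supp_null.
exact: measurable_closed_borelRd.
Qed.

(** * Hausdorff content *)

Lemma gauge_small (R : realType) (f : R -> R) (e : R) :
  gauge_function f -> 0 < e -> exists2 r, 0 < r & f r <= e.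
Proof.
move=> [f0 fi _ f_0] e0.
have : \forall t \near 0^'+, `|0 - f t| <= e by apply/cvgrPdist_le: e e0.
move=> h; have [r] : exists r, 0 < r /\ `|0 - f r| <= e.
  apply: (@filter_ex _ (0^'+ : set_system R)); near=> t; split; near: t => //.
  exact: nbhs_right_gt.
move=> [r0]; rewrite sub0r normrN => fr; exists r => //.
exact: le_trans (ler_norm _) fr.
Unshelve. all: by end_near. Qed.

Lemma is_open_ball_eball (R : realType) d (x : 'rV[R]_d) (r : R) :
  0 < r -> is_open_ball (eball x r).
Proof. by move=> r0; exists x, r. Qed.

Lemma gauge_ball_ge0 (R : realType) d (f : R -> R) (B : set 'rV[R]_d) :
  (0 < d)%N -> gauge_function f -> is_open_ball B -> 0 <= f (ediam B).
Proof.
by move=> d0 gf [x [r [r0 ->]]]; rewrite ltW// gauge_gt0// ediam_eball_gt0.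
Qed.

Lemma hcontent_ge0 (R : realType) d (f : R -> R) (A : set 'rV[R]_d) :
  (0 < d)%N -> gauge_function f -> (0 <= hcontent f A)%E.
Proof.
move=> d0 gf; apply: le_ereal_inf_tmp => _ [B [ballB _ ->]].
by apply: nneseries_ge0 => j _ _; rewrite lee_fin gauge_ball_ge0.
Qed.

Lemma hcontentS (R : realType) d (f : R -> R) (A B : set 'rV[R]_d) :
  A `<=` B -> (hcontent f A <= hcontent f B)%E.
Proof.
move=> AB; apply: le_ereal_inf => _ [C [ballC BC ->]].
by exists C; split => //; exact: subset_trans BC.
Qed.

(** Covers are infinite sequences of nondegenerate balls, so the single ball is completed by tiny
    balls whose total cost is at most [e]. *)
Lemma hcontent_le_gauge (R : realType) d (f : R -> R) (A : set 'rV[R]_d) x (r : R) :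
  (0 < d)%N -> gauge_function f -> 0 < r -> A `<=` eball x r ->
  (hcontent f A <= (f (d%:R * (r + r)))%:E)%E.
Proof.
move=> d0 gf r0 Ar; apply/lee_addgt0Pr => /= e e0.
have dr : 0 < d%:R :> R by rewrite ltr0n.
have small (j : nat) : exists2 t, 0 < t & f (d%:R * (t + t)) <= e / (2 ^ j.+1)%:R.
  have ej : 0 < e / (2 ^ j.+1)%:R by rewrite divr_gt0// ltr0n expn_gt0.
  have [t t0 ft] := gauge_small gf ej.
  (* With this radius the diameter bound d (rho + rho) is exactly [t]. *)
  exists (t / (2 * d%:R)); first by rewrite divr_gt0// mulr_gt0.
  by rewrite (_ : d%:R * _ = t)//; field; rewrite gt_eqF.
pose rho j := sval (cid2 (small j)).
have rho0 j : 0 < rho j by rewrite /rho; case: cid2.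
have frho j : f (d%:R * (rho j + rho j)) <= e / (2 ^ j.+1)%:R by rewrite /rho; case: cid2.
pose B j := if j == 0%N then eball x r else eball 0 (rho j).
have ballB j : is_open_ball (B j).
  by rewrite /B; case: ifP => _; exact: is_open_ball_eball.
pose a (j : nat) : \bar R := if j == 0%N then (f (d%:R * (r + r)))%:E else 0%E.
have fr0 : 0 <= f (d%:R * (r + r)) by rewrite ltW// gauge_gt0// mulr_gt0// addr_gt0.
have a0 j : (0 <= a j)%E by rewrite /a; case: ifP.
have suma : (\sum_(0 <= j <oo) a j <= (f (d%:R * (r + r)))%:E)%E.
  apply: lime_le; first exact: is_cvg_nneseries.
  apply: nearW => -[|n]; first by rewrite big_geq.
  by rewrite big_mkord big_ord_recl/= big1 ?adde0.
apply: le_trans (leeD2r _ suma).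
apply: le_trans (epsilon_trick xpredT a0 (ltW e0)).
apply: (@le_trans _ _ (\sum_(0 <= j <oo) (f (ediam (B j)))%:E)%E).
  apply: ereal_inf_lbound; exists B; split => // y /Ar ry.
  by exists 0%N.
apply: lee_nneseries => [j _ _|j _]; first by rewrite lee_fin gauge_ball_ge0.
have leB t c : 0 < t -> f (ediam (eball c t : set 'rV[R]_d)) <= f (d%:R * (t + t)).
  by move=> t0; apply: gauge_le => //; [exact: ediam_eball_gt0|exact: ediam_eball_le].
rewrite /a /B; case: ifPn => [_|_]; rewrite -EFinD lee_fin.
  by rewrite ler_wpDr ?leB// divr_ge0 ?ler0n// ltW.
by rewrite add0r (le_trans (leB _ _ (rho0 j))).
Qed.

(** Two nearly optimal covers are interleaved, one on the even indices and the other on the odd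
    ones. *)
Lemma hcontentU (R : realType) d (f : R -> R) (A B : set 'rV[R]_d) :
  (0 < d)%N -> gauge_function f ->
  (hcontent f (A `|` B) <= hcontent f A + hcontent f B)%E.
Proof.
move=> d0 gf.
have [hA|hA] := eqVneq (hcontent f A) +oo%E.
  by rewrite hA addye ?leey// gt_eqF// (lt_le_trans _ (hcontent_ge0 _ d0 gf))// ltNye.
have [hB|hB] := eqVneq (hcontent f B) +oo%E.
  by rewrite hB addey ?leey// gt_eqF// (lt_le_trans _ (hcontent_ge0 _ d0 gf))// ltNye.
have fA : hcontent f A \is a fin_num by rewrite ge0_fin_numE ?hcontent_ge0// lt_neqAle hA leey.
have fB : hcontent f B \is a fin_num by rewrite ge0_fin_numE ?hcontent_ge0// lt_neqAle hB leey.
apply/lee_addgt0Pr => e e0; have e20 : 0 < e / 2 by rewrite divr_gt0.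
have [_ [C1 [bC1 AC1 ->]] s1] := lb_ereal_inf_adherent e20 fA.
have [_ [C2 [bC2 BC2 ->]] s2] := lb_ereal_inf_adherent e20 fB.
pose C j := if odd j then C2 j./2 else C1 j./2.
have bC j : is_open_ball (C j) by rewrite /C; case: ifP.
rewrite [e in (_ + e%:E)%E]splitr EFinD addeACA.
apply: le_trans (leeD (ltW s1) (ltW s2)).
apply: (@le_trans _ _ (\sum_(0 <= j <oo) (f (ediam (C j)))%:E)%E).
  apply: ereal_inf_lbound; exists C; split => // x [/AC1|/BC2] [j _ Cx].
    by exists j.*2 => //; rewrite /C odd_double doubleK.
  by exists j.*2.+1 => //; rewrite /C/= odd_double/= uphalf_double.
have f0 D j : (forall j : nat, is_open_ball (D j)) -> (0 <= (f (@ediam R d (D j)))%:E)%E.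
  by move=> bD; rewrite lee_fin gauge_ball_ge0.
apply: lime_le; first by apply: is_cvg_nneseries => n _ _; exact: f0.
apply: nearW => n.
(* The partial sum up to 2n splits exactly into the first n terms of each cover. *)
have : (\sum_(0 <= j < n) (f (ediam (C j)))%:E <= \sum_(0 <= j < n.*2) (f (ediam (C j)))%:E)%E.
  by apply: lee_sum_nneg_natr => // [j _ _|]; [exact: f0|rewrite -addnn leq_addr].
move=> /le_trans; apply.
rewrite (_ : \sum_(0 <= j < n.*2) _ =
    \sum_(0 <= j < n) (f (ediam (C1 j)))%:E + \sum_(0 <= j < n) (f (ediam (C2 j)))%:E)%E.
  by apply: leeD; apply: nneseries_lim_ge => j _ _; exact: f0.
elim: n => [|n IH]; first by rewrite !big_geq// adde0.
rewrite doubleS !big_nat_recr//= IH /C/= odd_double/= doubleK uphalf_double.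
by rewrite addeACA addeA.
Qed.

(** * Frostman measures from nets *)

Lemma stieltjes_measure_exists (R : realType) (G : R -> R) :
  {homo G : x y / x <= y} ->
  (forall x : R, G t @[t --> x^'+] --> G x) ->
  exists lam : {measure set (measurableTypeR R) -> \bar R},
    forall a b : R, a <= b -> lam `]a, b]%classic = (G b - G a)%:E.
Proof.
move=> ndG rcG.
pose G' : cumulative R R := HB.pack G (isCumulative.Build R _ R G ndG rcG).
exists (lebesgue_stieltjes_measure G') => a b ab.
transitivity (wlength G' `]a, b]%classic).
  exact: (measurable_mu_extE (wlength G') (is_ocitv a b)).
by rewrite wlength_itv_bnd.
Qed.

(** The Stieltjes measure lives on the whole line, whereas addresses are encoded in ]0, 1]; hence
    the restriction to [D] before taking the image. *)
Lemma pushforward_restr_exists d1 d2 (T1 : measurableType d1)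
    (T2 : measurableType d2) (R : realType) (lam : {measure set T1 -> \bar R})
    (D : set T1) (f : T1 -> T2) :
  measurable D -> measurable_fun setT f ->
  exists mu : {measure set T2 -> \bar R}, forall A, mu A = lam (f @^-1` A `&` D).
Proof.
move=> mD mf; pose mf_mixin := isMeasurableFun.Build _ _ _ _ f mf.
pose f' : {mfun T1 >-> T2} := HB.pack f mf_mixin.
pose lam0 : {measure set T1 -> \bar R} := mrestr lam mD.
have [mu muE] : exists mu : {measure set T2 -> \bar R}, forall A, mu A = pushforward lam0 f' A.
  by unshelve eexists (pushforward lam0 f' : {measure set T2 -> \bar R}).
by exists mu.
Qed.

(* [a n x] is the address of the cell of generation [n] containing [x]; the
   addresses are nested N-adically, so the cells of [E] correspond to N-adic
   intervals of ]0, 1], and [psi] maps an interval near its cell. *)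
Section net_measure.
Context (R : realType) (d : nat) (E : set 'rV[R]_d) (c : set 'rV[R]_d -> R).
Context (N : nat) (a : nat -> 'rV[R]_d -> nat) (psi : R -> 'rV[R]_d).
Context (s phi : nat -> R) (K : nat).

Definition net_cell n m : set 'rV[R]_d := [set x | E x /\ a n x = m].

(** Open on the left and closed on the right, so that its Stieltjes measure is an increment of the
    distribution function. *)
Definition net_itv n m : set R :=
  `]m%:R / N%:R ^+ n, m.+1%:R / N%:R ^+ n]%classic.

(** The condition says that some cell containing [x] has an interval ending at or before [t]. *)
Definition net_prefix (t : R) : set 'rV[R]_d :=
  [set x | E x /\ exists n, (a n x).+1%:R <= t * N%:R ^+ n].

Hypothesis c0 : c set0 = 0.
Hypothesis cS : forall A B, A `<=` B -> B `<=` E -> c A <= c B.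
Hypothesis cU : forall A B, A `<=` E -> B `<=` E -> c (A `|` B) <= c A + c B.
Hypothesis N0 : (0 < N)%N.
Hypothesis a0 : forall x, a 0 x = 0%N.
Hypothesis aS : forall n x, (a n.+1 x %/ N)%N = a n x.
Hypothesis cphi : forall n m, c (net_cell n m) <= phi n.
Hypothesis phi0 : phi n @[n --> \oo] --> 0.
Hypothesis s0 : s n @[n --> \oo] --> 0.
Hypothesis sgt0 : forall n, 0 < s n.
Hypothesis psi_cell : forall n t x, E x -> net_itv n (a n x) t -> `|psi t - x| <= s n.
Hypothesis psi_empty : forall n m t u,
  net_cell n m = set0 -> net_itv n m t -> net_itv n m u -> psi t = psi u.
Hypothesis psi_out : forall t u : R, ~ `]0, 1]%classic t -> ~ `]0, 1]%classic u -> psi t = psi u.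
Hypothesis overlap : forall n (x : 'rV[R]_d), exists2 ms : seq nat, (size ms <= K)%N &
  forall y, E y -> `|y - x| <= s n + s n -> a n y \in ms.
Hypothesis clE : closed E.

Lemma addr_div n k x : (a (n + k) x %/ N ^ k)%N = a n x.
Proof.
elim: k => [|k IH]; first by rewrite addn0 expn0 divn1.
by rewrite addnS expnS divnMA aS.
Qed.

Let NR n : 0 < N%:R ^+ n :> R. Proof. by rewrite exprn_gt0// ltr0n. Qed.

(** If k <= n, the interval of generation n containing the code of [x] lies inside the one of
    generation k. If k > n, then m / N^n is an endpoint of both generations, so the coarser interval
    cannot go beyond it either. *)
Lemma addr_ltn n m x k (t : R) : t <= m%:R / N%:R ^+ n ->
  (a k x).+1%:R <= t * N%:R ^+ k -> (a n x < m)%N.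
Proof.
move=> tm xt.
have : ((a k x).+1 * N ^ n <= m * N ^ k)%N.
  rewrite -(ler_nat R) !natrM !natrX; move: tm; rewrite ler_pdivlMr// => tm.
  apply: le_trans (ler_wpM2r (ltW (NR n)) xt) _.
  by rewrite mulrAC ler_wpM2r// ltW.
have [kn|/ltnW nk] := leqP k n.
  have [j ->] : exists j, n = (k + j)%N by exists (n - k)%N; rewrite subnKC.
  rewrite expnD mulnCA [X in (_ <= X)%N]mulnC leq_pmul2l ?expn_gt0 ?N0//.
  apply: leq_trans; rewrite -(addr_div k j).
  by apply: ltn_ceil; rewrite expn_gt0 N0.
have [j ->] : exists j, k = (n + j)%N by exists (k - n)%N; rewrite subnKC.
rewrite expnD mulnCA [X in (X <= _)%N]mulnC leq_pmul2l ?expn_gt0 ?N0// => h.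
by rewrite -(addr_div n j) ltn_divLR ?expn_gt0 ?N0.
Qed.

Lemma net_prefix_le n m (t : R) : t <= m%:R / N%:R ^+ n ->
  net_prefix t `<=` [set x | E x /\ (a n x < m)%N].
Proof. by move=> tm x [Ex [k xk]]; split => //; exact: addr_ltn xk. Qed.

Lemma net_prefix_ge n m (t : R) : m%:R / N%:R ^+ n <= t ->
  [set x | E x /\ (a n x < m)%N] `<=` net_prefix t.
Proof.
move=> mt x [Ex xm]; split => //; exists n.
rewrite -ler_pdivrMr//; apply: le_trans mt.
by rewrite ler_pM2r ?invr_gt0// ler_nat.
Qed.

Lemma net_prefixS (t u : R) : t <= u -> net_prefix t `<=` net_prefix u.
Proof.
move=> tu x [Ex [n xn]]; split => //; exists n; apply: le_trans xn _.
by rewrite ler_pM2r.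
Qed.

Lemma net_prefix_sub t : net_prefix t `<=` E. Proof. by move=> x []. Qed.

(* By subadditivity the increment of [net_cdf] over the interval of a cell is at
   most the content of that cell, so no maximal flow on the tree of cells has to
   be constructed. *)
Definition net_cdf t := c (net_prefix t).

Lemma net_cdf_nd : {homo net_cdf : x y / x <= y}.
Proof. by move=> x y xy; apply: cS; [exact: net_prefixS|exact: net_prefix_sub]. Qed.

Lemma net_cdf_le0 (t : R) : t <= 0 -> net_cdf t = 0.
Proof.
move=> t0; rewrite /net_cdf (_ : net_prefix t = set0)// -subset0 => x.
by move=> /(@net_prefix_le 0 0); rewrite expr0 divr1 => -[].
Qed.

Lemma net_cdf1 : net_cdf 1 = c E.
Proof.
congr c; apply/seteqP; split; first exact: net_prefix_sub.
by move=> x Ex; split => //; exists 0%N; rewrite a0 expr0 mulr1.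
Qed.

Lemma net_cdf_incr n m (t u : R) : m%:R / N%:R ^+ n <= t -> u <= m.+1%:R / N%:R ^+ n ->
  net_cdf u <= net_cdf t + c (net_cell n m).
Proof.
move=> mt um; apply: le_trans (cU (@net_prefix_sub t) _); last by move=> x [].
apply: cS; last by move=> x [[]|[]].
move=> x /(net_prefix_le um)[Ex]; rewrite ltnS leq_eqVlt => /predU1P[xm|xm].
  by right.
by left; apply: (net_prefix_ge mt).
Qed.

(** To the right of x >= 0 there is room inside the generation n interval that starts at or before
    [x], and the increment there is at most phi_n, which tends to 0. Near a negative [x] the
    function vanishes. *)
Lemma net_cdf_rc (x : R) : net_cdf t @[t --> x^'+] --> net_cdf x.
Proof.
apply/cvgrPdist_le => /= e e0; have [x0|x0] := ltP x 0.
  near=> t; have t0 : t <= 0 by near: t; exact: nbhs_right_le.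
  by rewrite (net_cdf_le0 t0) (net_cdf_le0 (ltW x0)) subrr normr0 ltW.
have : \forall n \near \oo, `|0 - phi n| <= e by apply/cvgrPdist_le: e e0.
move=> /(@filter_ex _ \oo)[n]; rewrite sub0r normrN => /(le_trans (ler_norm _)) phin.
pose m := Num.truncn (x * N%:R ^+ n).
have xN : 0 <= x * N%:R ^+ n by rewrite mulr_ge0// ltW.
near=> t; have xt : x <= t by near: t; exact: nbhs_right_ge.
rewrite distrC ger0_norm ?subr_ge0 ?net_cdf_nd// lerBlDl.
apply: le_trans (@net_cdf_incr n m x t _ _) _.
- by rewrite ler_pdivrMr// truncn_le.
- near: t; apply: nbhs_right_le; rewrite ltr_pdivlMr//.
  by rewrite truncnS_gt.
- by rewrite lerD2l (le_trans (cphi _ _)).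
Unshelve. all: by end_near. Qed.

Lemma net_itv_exists n t : `]0, 1]%classic t -> exists m, net_itv n m t.
Proof.
rewrite /= in_itv/= => /andP[t0 _]; pose y := t * N%:R ^+ n.
have y0 : 0 < y by rewrite mulr_gt0.
have /andP[ly uy] := truncn_itv (ltW y0).
have h m : m%:R < y <= m.+1%:R -> net_itv n m t.
  by rewrite /net_itv/= in_itv/= ltr_pdivrMr// ler_pdivlMr.
have [ty|ty] := eqVneq (Num.truncn y)%:R y; last first.
  by exists (Num.truncn y); apply: h; rewrite lt_neqAle ty ly ltW.
(* When [t] is a grid point it is the right end of its interval, so the index is one less than the
   truncation. *)
exists (Num.truncn y).-1; apply: h.
have ty0 : (0 < Num.truncn y)%N by rewrite -(ltr_nat R) ty.
by rewrite -{2 3}ty prednK// ltr_nat lexx andbT ltn_predL.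
Qed.

(** In the first case [t] lies in an interval that will carry no mass; in the second, [psi t] is a
    limit of points of [E]. *)
Lemma net_itv_shrink t : `]0, 1]%classic t -> 
  (exists n m, net_cell n m = set0 /\ net_itv n m t) \/
  (forall n, exists x, E x /\ net_itv n (a n x) t).
Proof.
move=> t01; have [h|/forallNP h] := pselect (exists n m, net_cell n m = set0 /\ net_itv n m t).
  by left.
right => n; have [m tm] := net_itv_exists n t01.
have /set0P[x [Ex xm]] : net_cell n m != set0.
  by apply/negP => /eqP nm; apply: (h n); exists m.
by exists x; split => //; rewrite xm.
Qed.

(** On an interval of an empty cell [psi] is constant, and on one of a nonempty cell of generation n
    it oscillates by at most 2 s_n. Inside ]0, 1] the preimage of an open set is therefore a
    countable union of net intervals; outside, [psi] is constant. *)
Lemma measurable_psi (U : set 'rV[R]_d) : open U ->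
  measurable (psi @^-1` U : set (measurableTypeR R)).
Proof.
move=> oU; pose W := \bigcup_n \bigcup_(m in [set m | net_itv n m `<=` psi @^-1` U]) net_itv n m.
have mW : measurable (W : set (measurableTypeR R)).
  apply: bigcupT_measurable => n; apply: bigcup_measurable => m _.
  exact: measurable_itv.
have WU : W `<=` psi @^-1` U by move=> t [n _ [m /= h tm]]; exact: h.
rewrite (_ : _ @^-1` U = W `|` (psi @^-1` U `&` ~` `]0, 1])); last first.
  apply/seteqP; split => t; last by case => [/WU|[]].
  move=> Ut; have [t01|nt01] := pselect (`]0, 1]%classic t); last by right.
  left; have [[n [m [nm tm]]]|h] := net_itv_shrink t01.
    exists n => //; exists m => //= u um.
    by rewrite /preimage/= -(psi_empty nm tm um).
  have /nbhs_ballP[r /= r0 rU] : nbhs (psi t) U by exact: open_nbhs_nbhs.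
  have r2 : 0 < r / 2 by rewrite divr_gt0.
  have : \forall n \near \oo, `|0 - s n| < r / 2 by apply/cvgrPdist_lt: (r / 2) r2.
  move=> /(@filter_ex _ \oo)[n]; rewrite sub0r normrN gtr0_norm// => sn.
  have [x [Ex tx]] := h n.
  exists n => //; exists (a n x) => //= u ux; apply: rU.
  rewrite mx_norm_ball /ball_/= -(subrKA x) (le_lt_trans (ler_normD _ _))//.
  rewrite [r]splitr ltrD// ?(le_lt_trans _ sn)//; first exact: psi_cell.
  by rewrite distrC; exact: psi_cell.
apply: measurableU => //.
have [[u [u01 Uu]]|h] := pselect (exists u, ~ `]0, 1]%classic u /\ U (psi u)).
  rewrite (_ : _ `&` _ = ~` `]0, 1]); first by apply: measurableC; exact: measurable_itv.
  by apply/seteqP; split => [t []//|t t01]; split => //=; rewrite (psi_out t01 u01).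
rewrite (_ : _ `&` _ = set0)// -subset0 => t [Ut t01].
by apply: h; exists t.
Qed.

Theorem net_measure_exists :
  exists mu : {measure set (borelRd R d) -> \bar R},
    [/\ mu setT = (c E)%:E, mu (~` E) = 0%E &
        forall (x : 'rV[R]_d) n, (mu (ball x (s n)) <= (K%:R * phi n)%:E)%E].
Proof.
have [lam lamE] := stieltjes_measure_exists net_cdf_nd net_cdf_rc.
have m01 : measurable (`]0, 1]%classic : set (measurableTypeR R)) by exact: measurable_itv.
have mpsi : measurable_fun [set: measurableTypeR R] (psi : measurableTypeR R -> borelRd R d).
  apply: (@measurability _ _ (measurableTypeR R) (borelRd R d) _ _ (@open 'rV[R]_d)) => //.
  by move=> _ [U oU <-]; rewrite setTI; exact: measurable_psi.
have lam_itv n m : (lam (net_itv n m) <= (c (net_cell n m))%:E)%E.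
  rewrite lamE ?lee_fin; first by rewrite lerBlDl; exact: net_cdf_incr.
  by rewrite ler_pM2r ?invr_gt0// ler_nat.
have mitv n m : measurable (net_itv n m : set (measurableTypeR R)) by exact: measurable_itv.
(* [Z] gathers the intervals of empty cells; each has mass at most c(set0) = 0. *)
pose Z : set (measurableTypeR R) := \bigcup_n \bigcup_(m in [set m | net_cell n m = set0]) net_itv n m.
have mZ : measurable Z.
  by apply: bigcupT_measurable => n; apply: bigcup_measurable => m _.
have Z0 : lam Z = 0%E.
  apply/negligibleP => //; apply: negligible_bigcup => n.
  rewrite bigcup_mkcond; apply: negligible_bigcup => m.
  case: ifPn => [/set_mem/= mn|_]; last exact: negligible_set0.
  apply/negligibleP => //; apply/eqP; rewrite eq_le measure_ge0 andbT.
  by rewrite (le_trans (lam_itv _ _))// mn c0.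
have Z_le0 : (lam Z <= 0)%E by rewrite Z0.
have phi_ge0 n : 0 <= phi n.
  apply: le_trans (cphi n 0); rewrite -c0; apply: cS; first exact: sub0set.
  by move=> x [].
have [mu muE] := pushforward_restr_exists lam m01 mpsi.
have oEC : open (~` E) by exact: closed_openC.
exists mu; split.
- rewrite muE preimage_setT setTI lamE// net_cdf1.
  by rewrite (@net_cdf_le0 0)// subr0.
- rewrite muE; apply/eqP; rewrite eq_le measure_ge0 andbT -Z0.
  apply: le_measureS => //.
    by apply: measurableI => //; exact: measurable_psi.
  move=> t [Et t01]; have [[n [m [nm tm]]]|h] := net_itv_shrink t01.
    by exists n => //; exists m.
  exfalso; apply: Et; rewrite (closure_id E).1//; move=> U.
  move=> /nbhs_ballP[r /= r0 rU].
  have : \forall n \near \oo, `|0 - s n| < r by move/cvgrPdist_lt: s0; exact.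
  move=> /(@filter_ex _ \oo)[n]; rewrite sub0r normrN gtr0_norm// => sn.
  have [x [Ex tx]] := h n; exists x; split => //; apply: rU.
  by rewrite mx_norm_ball /ball_/= (le_lt_trans _ sn)//; exact: psi_cell.
- move=> x n; rewrite muE.
  have [ms msK hms] := overlap n x.
  have mU (l : seq nat) : measurable (\big[setU/set0]_(m <- l) net_itv n m : set (measurableTypeR R)).
    by apply: bigsetU_measurable.
  apply: (@le_trans _ _ (lam (Z `|` \big[setU/set0]_(m <- ms) net_itv n m))).
    apply: le_measureS.
    + apply: measurableI => //; apply: measurable_psi; exact: ball_open.
    + exact: measurableU.
    move=> t [xt t01]; have [[k [m [nm tm]]]|h] := net_itv_shrink t01.
      by left; exists k => //; exists m.
    (* Off [Z], a point of [E] coded near [t] is within s_n of [psi t], hence within 2 s_n of [x],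
       so its cell is one of the at most [K] listed. *)
    right; have [y [Ey ty]] := h n.
    rewrite -bigcup_seq; exists (a n y) => //=; apply: hms => //.
    rewrite -(subrKA (psi t)) (le_trans (ler_normD _ _))// lerD//.
      by rewrite distrC; exact: psi_cell.
    by move: xt; rewrite mx_norm_ball /ball_/= distrC => /ltW.
  apply: le_trans (measureU2 _ _ _) _ => //.
  apply: le_trans (leeD Z_le0 (lexx _)) _; rewrite add0e.
  apply: (@le_trans _ _ ((size ms)%:R * phi n)%:E); last first.
    by rewrite lee_fin ler_wpM2r// ler_nat.
  elim: ms {msK hms} => [|m ms IH]; first by rewrite big_nil measure0 mul0r.
  rewrite big_cons; apply: le_trans (measureU2 _ _ _) _ => //.
  by rewrite -natr1 mulrDl mul1r addrC EFinD leeD// (le_trans (lam_itv _ _))// lee_fin cphi.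
Qed.
End net_measure.

(** * Dyadic cubes *)

Lemma norm_le_coord (R : realType) d (x : 'rV[R]_d) (r : R) :
  0 <= r -> (forall i, `|x 0 i| <= r) -> `|x| <= r.
Proof.
move=> r0 xr; rewrite [X in X <= _]mx_normrE; apply: bigmax_le => // -[i j] _ /=.
by rewrite (ord1 i).
Qed.

Lemma truncn_lt0 (R : realType) (y : R) : y < 0 -> Num.truncn y = 0%N.
Proof. by move=> y0; rewrite truncn_floor leNgt y0. Qed.

Section grid.
Context (R : realType) (d : nat) (E : set 'rV[R]_d) (o : 'rV[R]_d) (L : R).
Hypothesis L0 : 0 < L.
Hypothesis EL : forall x i, E x -> 0 <= x 0 i - o 0 i < L.

(** The coordinate relative to the corner [o], in units of the cube side of generation n. *)
Definition grid_pos n (x : 'rV[R]_d) i : R := 2 ^+ n * ((x 0 i - o 0 i) / L).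

Definition grid_coord n x i : nat := Num.truncn (grid_pos n x i).

(** The parities tell, in each direction, which half of the cube of generation n contains [x];
    together they form one digit of the address. *)
Definition grid_digit n x : {ffun 'I_d -> bool} :=
  [ffun i => odd (grid_coord n.+1 x i)].

(** This is 2^d, written as a cardinal so that [enum_rank] directly yields digits below it. *)
Definition grid_base : nat := #|{ffun 'I_d -> bool}|.

Fixpoint grid_addr n x : nat :=
  if n is m.+1 then (grid_addr m x * grid_base + enum_rank (grid_digit m x))%N
  else 0%N.

Definition grid_side n : R := L / 2 ^+ n.

Let itv n m := @net_itv R grid_base n m.

(* The supremum is over the lower corners of the cubes whose interval contains
   [t]; it is [0] when [t] lies outside ]0, 1]. *)
Definition grid_param (t : R) : 'rV[R]_d :=
  \row_i (o 0 i + L * sup [set r | exists n x,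
    [/\ E x, itv n (grid_addr n x) t & r = (grid_coord n x i)%:R / 2 ^+ n]]).

Lemma grid_base_gt0 : (0 < grid_base)%N.
Proof. by apply/card_gt0P; exists [ffun => false]. Qed.

Lemma grid_addrS n x : (grid_addr n.+1 x %/ grid_base)%N = grid_addr n x.
Proof. by rewrite /= divnMDl ?grid_base_gt0// divn_small ?addn0. Qed.

(** Dyadic cubes are nested because halving floor(2y) gives floor(y); for negative y both
    truncations are 0. *)
Lemma grid_coordS n x i : (grid_coord n.+1 x i)./2 = grid_coord n x i.
Proof.
rewrite /grid_coord /grid_pos exprS -mulrA; set y := 2 ^+ n * _.
have [y0|y0] := leP 0 y; last first.
  by rewrite !truncn_lt0// pmulr_rlt0.
have /andP[l u] := truncn_itv y0; have y20 : 0 <= 2 * y by rewrite mulr_ge0.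
have /andP[l2 u2] := truncn_itv y20.
apply/eqP; rewrite eqn_leq -divn2 -ltnS ltn_divLR// leq_divRL//.
rewrite truncn_lt_nat// truncn_ge_nat// !natrM; apply/andP; split; lra.
Qed.

Lemma grid_coord_divn n k x i : (grid_coord (n + k) x i %/ 2 ^ k)%N = grid_coord n x i.
Proof.
elim: k => [|k IH]; first by rewrite addn0 expn0 divn1.
by rewrite addnS expnS divnMA divn2 grid_coordS.
Qed.

Lemma grid_pos_ge0 n x i : E x -> 0 <= grid_pos n x i.
Proof.
by move=> /EL - /(_ i) /andP[h _]; rewrite mulr_ge0 ?exprn_ge0// divr_ge0// ltW.
Qed.

Lemma grid_coord0 x i : E x -> grid_coord 0 x i = 0%N.
Proof.
move=> Ex; apply: truncn_def; rewrite grid_pos_ge0//= /grid_pos expr0 mul1r.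
by rewrite ltr_pdivrMr// mul1r; have /andP[] := EL i Ex.
Qed.

(** All of [E] lies in one cube of generation 0. From there, the quotient of the address recovers
    the halves of the coordinates and its last digit their parities. *)
Lemma grid_coord_eq n x y : E x -> E y -> grid_addr n x = grid_addr n y ->
  grid_coord n x =1 grid_coord n y.
Proof.
move=> Ex Ey; elim: n => [_ i|n IH /= h i]; first by rewrite !grid_coord0.
have hn : grid_addr n x = grid_addr n y by rewrite -(grid_addrS n x) -(grid_addrS n y)/= h.
rewrite hn in h; move/addnI/val_inj/enum_rank_inj/ffunP : h => /(_ i).
rewrite !ffunE => oxy; rewrite -(odd_double_half (grid_coord _ x i)).
by rewrite -(odd_double_half (grid_coord _ y i)) !grid_coordS IH// oxy.
Qed.

Lemma grid_addr_eq n x y : grid_coord n x =1 grid_coord n y ->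
  grid_addr n x = grid_addr n y.
Proof.
elim: n => // n IH h /=; congr (_ * _ + _)%N.
  by apply: IH => i; rewrite -(grid_coordS n x) -(grid_coordS n y) h.
by congr (nat_of_ord (enum_rank _)); apply/ffunP => i; rewrite !ffunE h.
Qed.

(** N-adic intervals that share a point are nested, and dropping the last k digits of the finer
    index gives the coarser one. *)
Lemma net_itv_div n k m m' t : itv n m t -> itv (n + k) m' t ->
  (m' %/ grid_base ^ k)%N = m.
Proof.
have N0 := grid_base_gt0; rewrite /itv /net_itv /= !in_itv/=.
have Nn j : 0 < grid_base%:R ^+ j :> R by rewrite exprn_gt0// ltr0n.
rewrite !ltr_pdivrMr// !ler_pdivlMr// exprD mulrA => /andP[l u] /andP[l' u'].
have Nk : (0 < grid_base ^ k)%N by rewrite expn_gt0 N0.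
apply/eqP; rewrite eqn_leq -ltnS ltn_divLR// leq_divRL//.
rewrite -(ltr_nat R) -[X in _ && X]ltnS -[X in _ && X](ltr_nat R) !natrM natrX.
apply/andP; split.
  by apply: lt_le_trans l' _; rewrite ler_pM2r.
by apply: lt_le_trans u'; rewrite ltr_pM2r.
Qed.

Lemma net_itv_sub n k m t : itv (n + k) m t -> itv n (m %/ grid_base ^ k)%N t.
Proof.
have N0 := grid_base_gt0; rewrite /itv /net_itv /= !in_itv/=.
have Nn j : 0 < grid_base%:R ^+ j :> R by rewrite exprn_gt0// ltr0n.
have Nk : (0 < grid_base ^ k)%N by rewrite expn_gt0 N0.
rewrite !ltr_pdivrMr// !ler_pdivlMr// exprD mulrA => /andP[l u].
rewrite -(ltr_pM2r (Nn k)) -[X in _ && X](ler_pM2r (Nn k)).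
apply/andP; split.
  by apply: le_lt_trans l; rewrite -natrX -natrM ler_nat leq_trunc_div.
by apply: le_trans u _; rewrite -natrX -natrM ler_nat ltn_ceil.
Qed.

Lemma grid_addr_divn n k x : (grid_addr (n + k) x %/ grid_base ^ k)%N = grid_addr n x.
Proof. by apply: addr_div => m y; exact: grid_addrS. Qed.

(** Compared with the cube of [x], a coarser cube whose interval contains [t] encloses it, and a
    finer one lies within it; in both cases its lower corner is at most the upper corner of the cube
    of [x]. *)
Lemma grid_param_ub n x i t : E x -> itv n (grid_addr n x) t ->
  ubound [set r : R | exists n x,
    [/\ E x, itv n (grid_addr n x) t & r = (grid_coord n x i)%:R / 2 ^+ n]]
  ((grid_coord n x i).+1%:R / 2 ^+ n).
Proof.
move=> Ex tx _ [k [y [Ey ty ->]]].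
have p2 j : 0 < 2 ^+ j :> R by rewrite exprn_gt0.
rewrite ler_pdivrMr// mulrAC ler_pdivlMr// -!natrX -!natrM ler_nat.
have [kn|/ltnW nk] := leqP k n.
  have [j nE] : exists j, n = (k + j)%N by exists (n - k)%N; rewrite subnKC.
  move: tx; rewrite nE => tx; have := net_itv_div ty tx.
  rewrite grid_addr_divn => /(grid_coord_eq Ex Ey)/(_ i) <-.
  rewrite -(grid_coord_divn k j) expnD mulnCA [X in (_ <= X)%N]mulnC leq_pmul2l ?expn_gt0//.
  exact: leq_trans (leq_trunc_div _ _) (leqnSn _).
have [j kE] : exists j, k = (n + j)%N by exists (k - n)%N; rewrite subnKC.
move: ty; rewrite kE => ty; have := net_itv_div tx ty.
rewrite grid_addr_divn => /(grid_coord_eq Ey Ex)/(_ i) <-.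
rewrite -(grid_coord_divn n j y) expnD mulnCA [X in (X <= _)%N]mulnC leq_pmul2l ?expn_gt0//.
by rewrite ltnW// ltn_ceil// expn_gt0.
Qed.

(** In each coordinate the supremum and [x] both lie between the lower and upper corners of the same
    cube. *)
Lemma grid_param_cell n t x : E x -> itv n (grid_addr n x) t ->
  `|grid_param t - x| <= grid_side n.
Proof.
move=> Ex tx; have p2 : 0 < 2 ^+ n :> R by rewrite exprn_gt0.
apply: norm_le_coord => [|i]; first by rewrite divr_ge0 ?ltW.
have ub := @grid_param_ub n x i t Ex tx.
rewrite !mxE; set S := [set r : R | _] in ub *.
have Sx : S ((grid_coord n x i)%:R / 2 ^+ n) by exists n, x.
have lo : (grid_coord n x i)%:R / 2 ^+ n <= sup S.
  by apply: ub_le_sup => //; eexists; exact: ub.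
have hi : sup S <= (grid_coord n x i).+1%:R / 2 ^+ n.
  by apply: sup_le_ub => //; eexists; exact: Sx.
have /andP[] := truncn_itv (grid_pos_ge0 n i Ex); rewrite -/(grid_coord n x i).
have -> : grid_pos n x i = 2 ^+ n * ((x 0 i - o 0 i) / L) by [].
rewrite -ler_pdivrMl// -ltr_pdivlMl// ![_^-1 * _]mulrC => a b.
set q := _%:R / _ in lo a; have qE : (grid_coord n x i).+1%:R / 2 ^+ n = q + (2 ^+ n)^-1.
  by rewrite -natr1 mulrDl mul1r.
rewrite qE in hi b; set z := (_ - _) / L in a b.
have -> : x 0 i = o 0 i + L * z by rewrite /z mulrCA divff ?gt_eqF// mulr1 subrKC.
rewrite /grid_side opprD addrACA subrr add0r -mulrBr normrM gtr0_norm// ler_pM2l//.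
by rewrite ler_norml; apply/andP; split; lra.
Qed.

(** No cube of generation at least n contributes, because it would put a point of [E] in the empty
    cell. Only coarser intervals remain, and these contain the whole interval of the cell. *)
Lemma grid_param_empty n m t u :
  net_cell E grid_addr n m = set0 -> itv n m t -> itv n m u ->
  grid_param t = grid_param u.
Proof.
move=> nm; pose S t i := [set r : R | exists n x,
    [/\ E x, itv n (grid_addr n x) t & r = (grid_coord n x i)%:R / 2 ^+ n]].
suff h : forall t u i, itv n m t -> itv n m u -> S t i `<=` S u i.
  move=> tm um; apply/rowP => i; rewrite !mxE; congr (_ + _ * sup _).
  by apply/seteqP; split; exact: h.
move=> {}t {}u i tm um _ [k [x [Ex tx ->]]]; exists k, x; split => //.
have [nk|/ltnW kn] := leqP n k.
  have [j kE] : exists j, k = (n + j)%N by exists (k - n)%N; rewrite subnKC.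
  exfalso; suff : net_cell E grid_addr n m x by rewrite nm.
  split => //.
  by move: tx; rewrite kE => /(net_itv_div tm); rewrite grid_addr_divn.
have [j nE] : exists j, n = (k + j)%N by exists (n - k)%N; rewrite subnKC.
move: tm um; rewrite nE => tm um; rewrite -(net_itv_div tx tm).
exact: net_itv_sub.
Qed.

Lemma grid_param_out t u : ~ `]0, 1]%classic t -> ~ `]0, 1]%classic u ->
  grid_param t = grid_param u.
Proof.
suff h v i : ~ `]0, 1]%classic v -> [set r : R | exists n x,
    [/\ E x, itv n (grid_addr n x) v & r = (grid_coord n x i)%:R / 2 ^+ n]] = set0.
  by move=> t01 u01; apply/rowP => i; rewrite !mxE !h.
move=> v01; rewrite -subset0 => r [n [x [Ex vx _]]]; apply: v01.
move: vx; rewrite -[n]add0n => /net_itv_sub; rewrite grid_addr_divn/=.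
by rewrite /itv /net_itv expr0 !divr1.
Qed.

(** A distance of two sides leaves five consecutive integers for each coordinate. Addresses are
    computed from points, so each vector of coordinates is represented by a chosen point of [E]; the
    choice does not affect the address. *)
Lemma grid_overlap n (x : 'rV[R]_d) :
  exists2 ms : seq nat, (size ms <= 5 ^ d)%N &
  forall y, E y -> `|y - x| <= grid_side n + grid_side n -> grid_addr n y \in ms.
Proof.
pose lo i := Num.truncn (grid_pos n x i - 2).
pose m (v : {ffun 'I_d -> 'I_5}) :=
  grid_addr n (xget 0 [set y | E y /\ forall i, grid_coord n y i = (lo i + v i)%N]).
exists [seq m v | v : {ffun 'I_d -> 'I_5}].
  by rewrite size_map -cardE card_ffun !card_ord.
move=> y Ey yx.
have p2 : 0 < 2 ^+ n :> R by rewrite exprn_gt0.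
have close i : `|grid_pos n y i - grid_pos n x i| <= 2.
  rewrite -mulrBr -mulrBl opprB addrA subrK.
  have := le_trans (coord_le_norm (y - x) i) yx; rewrite !mxE => h.
  rewrite normrM normrM gtr0_norm// (@gtr0_norm _ L^-1) ?invr_gt0//.
  rewrite mulrA ler_pdivrMr// mulrC -ler_pdivlMr//.
  by apply: le_trans h _; rewrite /grid_side mulr2n mulrDl mul1r mulrDl.
have loy i : (lo i <= grid_coord n y i < lo i + 5)%N.
  have := close i; rewrite ler_norml => /andP[c1 c2].
  rewrite truncn_ge_nat ?grid_pos_ge0// truncn_lt_nat ?grid_pos_ge0//.
  have := truncnS_gt (grid_pos n x i - 2); rewrite -/(lo i) -natr1 natrD => c3.
  apply/andP; split; last lra.
  have [w0|w0] := leP 0 (grid_pos n x i - 2).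
    by have := w0; rewrite -truncn_le -/(lo i) => c4; lra.
  by rewrite /lo truncn_lt0 ?grid_pos_ge0.
pose v : {ffun 'I_d -> 'I_5} := [ffun i => inord (grid_coord n y i - lo i)].
have vE i : grid_coord n y i = (lo i + v i)%N.
  have /andP[l u] := loy i; rewrite ffunE inordK; last by rewrite ltn_subLR.
  by rewrite subnKC.
apply/mapP; exists v; first by rewrite mem_enum.
have /(@xgetPex _ 0)[_ h] : exists y, [set y | E y /\ forall i, grid_coord n y i = (lo i + v i)%N] y.
  by exists y.
by apply: grid_addr_eq => i; rewrite h vE.
Qed.

End grid.

(** * Frostman measures on Euclidean space *)

Lemma gauge_comp_cvg0 (R : realType) (f : R -> R) (u : nat -> R) :
  gauge_function f -> (forall n, 0 < u n) -> u n @[n --> \oo] --> 0 ->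
  f (u n) @[n --> \oo] --> 0.
Proof.
move=> gf u0 cu; apply/cvgrPdist_le => /= e e0.
have [r r0 fr] := gauge_small gf e0.
have := cu; move/cvgrPdist_le => /(_ r r0); apply: filterS => n.
rewrite !sub0r !normrN gtr0_norm// gtr0_norm ?gauge_gt0// => ur.
exact: le_trans (gauge_le gf (u0 n) ur) fr.
Qed.

Lemma grid_side_cvg0 (R : realType) (L : R) : grid_side L n @[n --> \oo] --> (0 : R).
Proof.
rewrite (_ : grid_side L = geometric L (2^-1)).
  by apply: cvg_geometric; rewrite gtr0_norm// invf_lt1// ltr1n.
by apply/funext => n; rewrite /grid_side /= exprVn.
Qed.

Lemma frostman_measure_exists (R : realType) d (f : R -> R)
    (E : set 'rV[R]_d) (o : 'rV[R]_d) (L : R) :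
  (0 < d)%N -> gauge_function f -> closed E -> 0 < L ->
  (forall x i, E x -> 0 <= x 0 i - o 0 i < L) ->
  exists mu : {measure set (borelRd R d) -> \bar R},
    [/\ mu setT = hcontent f E,
        (hcontent f E <= (f (d%:R * (d.+1%:R * L + d.+1%:R * L)))%:E)%E,
        mu (~` E) = 0%E &
        forall (x : 'rV[R]_d) n, (mu (ball x (grid_side L n)) <=
          ((5 ^ d)%:R * f (d%:R * (d.+1%:R * grid_side L n + d.+1%:R * grid_side L n)))%:E)%E].
Proof.
move=> d0 gf clE L0 EL.
have s0 n : 0 < grid_side L n by rewrite divr_gt0// exprn_gt0.
(* Coordinates within [s] give a Euclidean distance at most d s; the factor d + 1 makes the
   inequality strict, as an open ball requires. *)
have ball_sub (A : set 'rV[R]_d) (x : 'rV[R]_d) (s : R) : 0 < s -> (forall y, A y -> forall i, `|y 0 i - x 0 i| <= s) ->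
    A `<=` eball x (d.+1%:R * s).
  move=> s1 h y Ay; rewrite /eball/=.
  have : enorm (y - x) <= d%:R * s.
    by apply: enorm_le => [|i]; [exact: ltW|rewrite !mxE h].
  by move=> /le_lt_trans; apply; rewrite ltr_pM2r// ltr_nat.
have hle (A : set 'rV[R]_d) (x : 'rV[R]_d) (s : R) : 0 < s -> (forall y, A y -> forall i, `|y 0 i - x 0 i| <= s) ->
    (hcontent f A <= (f (d%:R * (d.+1%:R * s + d.+1%:R * s)))%:E)%E.
  move=> s1 h; apply: (@hcontent_le_gauge _ _ _ _ x) => //; first by rewrite mulr_gt0.
  exact: ball_sub.
have hE : (hcontent f E <= (f (d%:R * (d.+1%:R * L + d.+1%:R * L)))%:E)%E.
  apply: (hle _ o) => // y Ey i.
  by have /andP[a b] := EL y i Ey; rewrite ger0_norm// ltW.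
have hfin (A : set 'rV[R]_d) : A `<=` E -> hcontent f A \is a fin_num.
  move=> AE; rewrite ge0_fin_numE ?hcontent_ge0//.
  by apply: le_lt_trans (hcontentS f AE) (le_lt_trans hE _); exact: ltry.
pose c (A : set 'rV[R]_d) := fine (hcontent f A).
pose phi n := f (d%:R * (d.+1%:R * grid_side L n + d.+1%:R * grid_side L n)).
have u0 n : 0 < d%:R * (d.+1%:R * grid_side L n + d.+1%:R * grid_side L n).
  by rewrite mulr_gt0 ?ltr0n// addr_gt0// mulr_gt0.
have phi_gt0 n : 0 < phi n by apply: (gauge_gt0 gf).
have phi_cvg : phi n @[n --> \oo] --> 0.
  apply: gauge_comp_cvg0 => //.
  rewrite (_ : (fun n => _) = grid_side (d%:R * (d.+1%:R * L + d.+1%:R * L))).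
    exact: grid_side_cvg0.
  by apply/funext => n; rewrite /grid_side; ring.
(* The empty set lies in balls of every size, and the gauge tends to 0. *)
have hc0 : hcontent f (set0 : set 'rV[R]_d) = 0%E.
  apply/eqP; rewrite eq_le hcontent_ge0// andbT.
  apply/lee_addgt0Pr => /= e e0; rewrite add0e.
  have := phi_cvg; move/cvgrPdist_le => /(_ e e0)/(@filter_ex _ \oo)[n].
  rewrite sub0r normrN gtr0_norm// => phin.
  by apply: le_trans (hle _ 0 _ (s0 n) _) _; rewrite ?lee_fin.
have c0 : c set0 = 0 by rewrite /c hc0.
have cS A B : A `<=` B -> B `<=` E -> c A <= c B.
  move=> AB BE; apply: fine_le; [|exact: hfin|exact: hcontentS].
  by apply: hfin; exact: subset_trans BE.
have cU A B : A `<=` E -> B `<=` E -> c (A `|` B) <= c A + c B.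
  move=> AE BE; have AB : A `|` B `<=` E by move=> x [/AE|/BE].
  by rewrite -lee_fin EFinD !fineK ?hfin// hcontentU.
have cphi n m : c (net_cell E (grid_addr o L) n m) <= phi n.
  set A := net_cell _ _ _ _.
  have AE : A `<=` E by move=> x [].
  have [[x [Ex xm]]|A0] := pselect (A !=set0); last first.
    rewrite (_ : A = set0) ?c0; first by rewrite ltW// gauge_gt0.
    by rewrite -subset0 => x Ax; apply: A0; exists x.
  rewrite -lee_fin fineK ?hfin//; apply: (hle _ x) => // y [Ey ym] i.
  have exy := @grid_coord_eq _ _ E o L L0 EL n x y Ex Ey (etrans xm (esym ym)) i.
  have /andP[x1 x2] := truncn_itv (@grid_pos_ge0 _ _ E o L L0 EL n x i Ex).
  have /andP[y1 y2] := truncn_itv (@grid_pos_ge0 _ _ E o L L0 EL n y i Ey).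
  rewrite -/(grid_coord o L n x i) -/(grid_coord o L n y i) -exy -!natr1 in x1 x2 y1 y2.
  have p2 : 0 < 2 ^+ n :> R by rewrite exprn_gt0.
  have -> : y 0 i - x 0 i = grid_side L n * (grid_pos o L n y i - grid_pos o L n x i).
    by rewrite /grid_pos /grid_side; field; rewrite !gt_eqF.
  rewrite normrM gtr0_norm// ger_pMr// ler_norml; apply/andP; split; lra.
have [mu [muT muC mub]] := @net_measure_exists R d E c (grid_base d) (grid_addr o L)
  (grid_param E o L) (grid_side L) phi (5 ^ d)%N c0 cS cU (grid_base_gt0 d)
  (fun=> erefl) (@grid_addrS _ _ o L) cphi phi_cvg (@grid_side_cvg0 _ L) s0
  (@grid_param_cell _ _ E o L L0 EL) (@grid_param_empty _ _ E o L)
  (@grid_param_out _ _ E o L) (@grid_overlap _ _ E o L L0 EL) clE.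
exists mu; split => //; by rewrite muT fineK// hfin.
Qed.

(** * Regularity of finite Borel measures *)

Section borel_regularity.
Context (R : realType) (d : nat).
Variable mu : {measure set (borelRd R d) -> \bar R}.
Hypothesis mufin : (mu setT < +oo)%E.

(** Inner and outer approximation are required together so that the class is stable under
    complement. *)
Definition sandwiched (A : set 'rV[R]_d) := forall e : R, 0 < e ->
  exists F U : set 'rV[R]_d, [/\ closed F, open U, F `<=` A, A `<=` U &
    (mu (U `\` F) <= e%:E)%E].

Let mopen (U : set 'rV[R]_d) : open U -> measurable (U : set (borelRd R d)).
Proof. exact: measurable_open_borelRd. Qed.
Let mclosed (U : set 'rV[R]_d) : closed U -> measurable (U : set (borelRd R d)).
Proof. exact: measurable_closed_borelRd. Qed.

Lemma measure_finite (A : set (borelRd R d)) : measurable A -> (mu A < +oo)%E.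
Proof. by move=> mA; apply: le_lt_trans mufin; exact: le_measureS. Qed.

Lemma measure_small_nonincreasing (A : (set (borelRd R d))^nat) (e : R) :
  (forall n, measurable (A n)) -> nonincreasing_seq A -> \bigcap_n A n = set0 ->
  0 < e -> exists n, (mu (A n) <= e%:E)%E.
Proof.
move=> mA ndA A0 e0.
have : mu \o A @ \oo --> 0%E.
  rewrite -(measure0 mu) -A0; apply: nonincreasing_cvg_mu => //.
    exact: measure_finite.
  by rewrite A0.
move/fine_cvgP => [_ /cvgrPdist_le/(_ e e0)/(@filter_ex _ \oo)[n]].
rewrite /= sub0r normrN ger0_norm ?fine_ge0// => h; exists n.
by rewrite -[mu _]fineK ?lee_fin// ge0_fin_numE// measure_finite.
Qed.

(** The neighbourhoods of radius 1/(n+1) of the complement meet [U] in sets decreasing to the empty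
    set. *)
Lemma sandwiched_open (U : set 'rV[R]_d) : open U -> sandwiched U.
Proof.
move=> oU e e0; pose V n := \bigcup_(y in ~` U) ball y (n.+1%:R^-1 : R).
have oV n : open (V n).
  by apply: bigcup_open => y _; apply: ball_open; rewrite invr_gt0.
have UV n : ~` U `<=` V n by move=> y Uy; exists y => //; apply: ballxx; rewrite invr_gt0.
have [n hn] : exists n, (mu (U `&` V n) <= e%:E)%E.
  apply: measure_small_nonincreasing => //.
  - by move=> n; apply: measurableI; exact: mopen.
  - move=> n m nm; apply/subsetPset => x [Ux [y Uy yx]]; split => //; exists y => //.
    by apply: le_ball yx; rewrite lef_pV2 ?posrE// ler_nat.
  - rewrite -subset0 => x h; have [Ux _] := h 0%N Logic.I.
    have /nbhs_ballP[r /= r0 rU] : nbhs x U by exact: open_nbhs_nbhs.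
    have [n nr] : exists n : nat, n.+1%:R^-1 < r.
      by apply: (@filter_ex _ \oo); exact: near_infty_natSinv_lt (PosNum r0).
    have [_ [y Uy yx]] := h n Logic.I; apply: Uy; apply: rU.
    by apply: (le_ball (ltW nr)); exact: ball_sym.
exists (~` V n), U; split => //.
- exact: open_closedC.
- by move=> x Vx; apply: contrapT => Ux; apply: Vx; exact: UV.
- by rewrite setDE setCK.
Qed.

Lemma sandwichedC (A : set 'rV[R]_d) : sandwiched A -> sandwiched (~` A).
Proof.
move=> h e e0; have [F [U [cF oU FA AU m]]] := h e e0.
exists (~` U), (~` F); split.
- exact: open_closedC.
- exact: closed_openC.
- exact: subsetC.
- exact: subsetC.
- by rewrite setDE setCK setIC -setDE.
Qed.

(** The individual errors add up to e/2. The union of the closed sets need not be closed, so it is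
    cut to a finite union at a further cost of e/2. *)
Lemma sandwiched_bigcup (A : (set 'rV[R]_d)^nat) :
  (forall n, sandwiched (A n)) -> sandwiched (\bigcup_n A n).
Proof.
move=> h e e0; have e2 : 0 < e / 2 by rewrite divr_gt0.
have e2n (n : nat) : 0 < (e / 2) / (2 ^ n.+1)%:R by rewrite divr_gt0// ltr0n expn_gt0.
have [F hF] := choice (fun n => h n _ (e2n n)).
have [U FUP] := choice hF.
have mF n : measurable (F n : set (borelRd R d)) by have [? _ _ _ _] := FUP n; exact: mclosed.
have mU n : measurable (U n : set (borelRd R d)) by have [_ ? _ _ _] := FUP n; exact: mopen.
pose UU := \bigcup_n U n.
have oUU : open UU by apply: bigcup_open => n _; have [] := FUP n.
pose G n := \bigcup_(i in `I_n) F i.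
have cG n : closed (G n).
  by apply: closed_bigcup => // i _; have [] := FUP i.
pose FF : set (borelRd R d) := \bigcup_n F n.
have mFF : measurable FF by exact: bigcupT_measurable.
have [n hn] : exists n, (mu (FF `\` G n) <= (e / 2)%:E)%E.
  apply: measure_small_nonincreasing => //.
  - by move=> n; apply: measurableD => //; exact: mclosed.
  - move=> n m nm; apply/subsetPset => x [Fx Gx]; split => // -[i /= im Fi].
    by apply: Gx; exists i => //=; exact: leq_trans nm.
  - rewrite -subset0 => x hx; have [[n _ Fx] _] := hx 0%N Logic.I.
    by have [_] := hx n.+1 Logic.I; apply; exists n => /=.
exists (G n), UU; split => //.
- by move=> x [i _ /= Fx]; exists i => //; have [_ _ s _ _] := FUP i; exact: s.
- by move=> x [i _ /= Ax]; exists i => //; have [_ _ _ s _] := FUP i; exact: s.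
have mUF : measurable (\bigcup_n (U n `\` F n) : set (borelRd R d)).
  by apply: bigcupT_measurable => k; exact: measurableD.
have mFG : measurable (FF `\` G n) by apply: measurableD => //; exact: mclosed.
have sub : UU `\` G n `<=` (\bigcup_n (U n `\` F n)) `|` (FF `\` G n).
  move=> x [[i _ Ux] Gx]; have [Fx|Fx] := pselect (F i x).
    by right; split => //; exists i.
  by left; exists i.
have mUG : measurable (UU `\` G n : set (borelRd R d)).
  by apply: measurableD; [exact: mopen|exact: mclosed].
have /le_trans := le_measureS mu mUG (measurableU _ _ mUF mFG) sub; apply.
apply: le_trans (measureU2 _ _ _) _ => //.
rewrite [e]splitr EFinD; apply: leeD => //.
apply: (@le_trans _ _ (\sum_(k <oo) mu (U k `\` F k))%E).
  by apply: measure_sigma_subadditive => // k; exact: measurableD.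
apply: (@le_trans _ _ (\sum_(k <oo) (0 + ((e / 2) / (2 ^ k.+1)%:R)%:E))%E).
  by apply: lee_nneseries => // k _; rewrite add0e; have [] := FUP k.
apply: le_trans (@epsilon_trick _ (fun=> 0%E) _ xpredT _ _) _ => //; first exact: ltW.
by rewrite eseries0 ?add0e.
Qed.

Lemma borel_sandwiched (A : set (borelRd R d)) : measurable A -> sandwiched A.
Proof.
apply: smallest_sub; last by move=> U; exact: sandwiched_open.
split.
- by apply: sandwiched_open; exact: open0.
- by move=> B; rewrite setTD; exact: sandwichedC.
- by move=> B; exact: sandwiched_bigcup.
Qed.

(** Intersecting the inner closed set with [E] makes it compact and loses only a null set. *)
Lemma radon_of_compact_support (E : set 'rV[R]_d) :
  compact E -> mu (~` E) = 0%E -> radon_measure mu.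
Proof.
move=> cE muE; have clE : closed E by apply: compact_closed => //; exact: norm_hausdorff.
have mK (K : set 'rV[R]_d) : compact K -> measurable (K : set (borelRd R d)).
  by move=> cK; apply: mclosed; apply: compact_closed => //; exact: norm_hausdorff.
split=> [K /mK|A mA]; first exact: measure_finite.
apply/eqP; rewrite eq_le; apply/andP; split; last first.
  by apply: ge_ereal_sup => _ [K [cK KA] <-]; apply: le_measureS => //; exact: mK.
apply/lee_addgt0Pr => /= e e0.
have [F [U [cF oU FA AU h]]] := borel_sandwiched mA e0.
have cFE : compact (E `&` F) by exact: compact_closedI.
apply: (@le_trans _ _ (mu (E `&` F) + e%:E)%E); last first.
  rewrite leeD2r//; apply: ereal_sup_ubound; exists (E `&` F) => //; split => //.
  by move=> x [_ /FA].
have mEC : measurable (~` E : set (borelRd R d)) by apply: mopen; exact: closed_openC.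
have mUF : measurable (U `\` F : set (borelRd R d)).
  by apply: measurableD; [exact: mopen|exact: mclosed].
have sub : A `<=` (E `&` F) `|` ((U `\` F) `|` ~` E).
  move=> x Ax; have [Ex|Ex] := pselect (E x); last by right; right.
  by have [Fx|Fx] := pselect (F x); [left|right; left; split => //; exact: AU].
have /le_trans := le_measureS mu mA (measurableU _ _ (mK _ cFE) (measurableU _ _ mUF mEC)) sub; apply.
apply: le_trans (measureU2 _ _ _) _; [exact: mK|exact: measurableU|].
rewrite leeD2l//; apply: le_trans (measureU2 _ _ _) _ => //.
by rewrite [X in (_ + X)%E]muE adde0.
Qed.

End borel_regularity.

(** * Summability *)

Lemma bounded_sums_telescope (R : realType) (r h : nat -> R) (n0 : nat) :
  (forall k, 0 <= r k) -> (forall k, 0 <= h k) ->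
  (forall k, (n0 <= k)%N -> r k.+1 <= h k - h k.+1) ->
  exists P : R, forall n, \sum_(k < n) r k <= P.
Proof.
move=> r0 h0 rh; exists (\sum_(k < n0.+1) r k + h n0) => n.
have tel j : \sum_(k < (n0 + j).+1) r k <= \sum_(k < n0.+1) r k + (h n0 - h (n0 + j)%N).
  elim: j => [|j IH]; first by rewrite !addn0 subrr addr0.
  rewrite addnS big_ord_recr /=; have := rh (n0 + j)%N (leq_addr _ _) => hj.
  lra.
apply: (@le_trans _ _ (\sum_(k < (n0 + n).+1) r k)).
  by rewrite -addSn addnC big_split_ord /= lerDl sumr_ge0.
by apply: le_trans (tel n) _; rewrite lerD2l lerBlDr lerDl.
Qed.

Lemma ln_le_subr1 (R : realType) (x : R) : 0 < x -> ln x <= x - 1.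
Proof. by move=> x0; have := expR_ge1Dx (ln x); rewrite lnK//; lra. Qed.

Lemma ln_sub_ge (R : realType) (x y : R) : 0 < x -> 0 < y ->
  (y - x) / y <= ln y - ln x.
Proof.
move=> x0 y0; have := @ln_le_subr1 _ (x / y) (divr_gt0 x0 y0).
by rewrite ln_div ?posrE// mulrBl divff ?gt_eqF//; lra.
Qed.

(* The derivative of [v |-> (ln v)^-e] is [- e / (v (ln v)^(1+e))]; convexity
   turns it into a bound on the increments. *)
Lemma ln_powR_incr (R : realType) (u v e : R) : 0 < e -> 1 < u -> u <= v ->
  e * ((v - u) / (v * ln v)) * ln v `^ (- e) <= ln u `^ (- e) - ln v `^ (- e).
Proof.
move=> e0 u1 uv; have v1 : 1 < v by exact: lt_le_trans uv.
have lu : 0 < ln u by exact: ln_gt0.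
have lv : 0 < ln v by exact: ln_gt0.
have u0 : 0 < u by lra.
have v0 : 0 < v by lra.
rewrite /powR !gt_eqF//; set p := - e * ln (ln u); set q := - e * ln (ln v).
have pq : e * ((v - u) / (v * ln v)) <= p - q.
  have -> : p - q = e * (ln (ln v) - ln (ln u)) by rewrite /p /q; ring.
  rewrite ler_pM2l//.
  apply: le_trans (ln_sub_ge lu lv).
  by rewrite invfM mulrA ler_pM2r ?invr_gt0// ln_sub_ge.
have := expR_ge1Dx (p - q) => h1.
rewrite [X in _ <= X](_ : _ = (expR (p - q) - 1) * expR q); last first.
  by rewrite mulrBl mul1r -expRD subrK.
by rewrite ler_wpM2r ?expR_ge0//; lra.
Qed.

Lemma ln_eventually_ge (R : realType) (M : R) :
  exists n0 : nat, forall n, (n0 <= n)%N -> M <= n%:R * ln 2.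
Proof.
have l2 : 0 < ln 2 :> R by rewrite ln_gt0// ltr1n.
exists (Num.truncn (M / ln 2)).+1 => n hn.
rewrite -ler_pdivrMr//; apply: le_trans (ltW (truncnS_gt _)) _.
by rewrite ler_nat.
Qed.

(** With V = log(2^k / a) and U = log(2^k / b), U <= 2V turns the ratio into at most a constant
    times 1 / (V (ln V)^(1+e)), which is compared with increments of (ln V)^(-e). *)
Lemma gauge_ratio_sums_bounded (R : realType) (d : nat) (alpha beta e : R)
    (f g : R -> R) (a b : R) :
  0 < e -> 1 <= beta -> 1 + e <= alpha -> 0 < a -> 0 < b ->
  gauge_extension d alpha beta f ->
  gauge_extension d (alpha - 1 - e) (beta - 1) g ->
  exists P : R, forall n, \sum_(k < n) f (a / 2 ^+ k) / g (b / 2 ^+ k) <= P.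
Proof.
move=> e0 be1 al1 a0 b0 [gf fE _] [gg gE _].
have l2 : 0 < ln 2 :> R by rewrite ln_gt0// ltr1n.
have p2 k : 0 < 2 ^+ k :> R by rewrite exprn_gt0.
pose v k := k%:R * ln 2 - ln a; pose u k := k%:R * ln 2 - ln b.
have lnE (c : R) k : 0 < c -> ln (c / 2 ^+ k)^-1 = k%:R * ln 2 - ln c.
  by move=> c0; rewrite invf_div ln_div ?posrE// lnXn// mulr_natl.
have leE (c : R) k : 0 < c -> 3 <= k%:R * ln 2 - ln c -> c / 2 ^+ k <= expR (- 3).
  move=> c0 h; rewrite -(@lnK _ (c / 2 ^+ k)) ?posrE ?divr_gt0// ler_expR.
  by have := lnE c k c0; rewrite lnV ?posrE ?divr_gt0//; lra.
set ga := alpha - 1 - e; have ga0 : 0 <= ga by rewrite /ga; lra.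
pose K := (a / b) ^+ d.-1 * 2 `^ (beta - 1) * 2 `^ ga.
have K0 : 0 <= K by rewrite !mulr_ge0 ?powR_ge0// exprn_ge0// divr_ge0// ltW.
(* The three thresholds put both arguments below exp(-3), where the explicit formula holds, and
   ensure U <= 2V. *)
have [n0 hn0] := ln_eventually_ge (Num.max (3 + ln a) (Num.max (3 + ln b) (2 * ln a - ln b))).
(* The factor 1 / (e ln 2) compensates for the constant e in the increment bound and the step ln 2
   between successive values of [v]. *)
pose h k := K / (e * ln 2) * ln (v k) `^ (- e).
apply: (@bounded_sums_telescope _ (fun k => f (a / 2 ^+ k) / g (b / 2 ^+ k)) h n0) => [k|k|k nk].
- by rewrite divr_ge0// ltW// gauge_gt0// divr_gt0.
- by rewrite mulr_ge0 ?powR_ge0// divr_ge0// mulr_ge0// ltW.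
have nk1 : (n0 <= k.+1)%N by exact: leqW.
have := hn0 _ nk; rewrite !ge_max => /andP[vk /andP[uk uvk]].
have := hn0 _ nk1; rewrite !ge_max => /andP[vk1 /andP[uk1 uvk1]].
have v3 : 3 <= v k by rewrite /v; lra.
have vS : v k.+1 = v k + ln 2 by rewrite /v -natr1; ring.
set V := v k.+1; set U := u k.+1.
have V3 : 3 <= V by rewrite /V /v; lra.
have U3 : 3 <= U by rewrite /U /u; lra.
have UV : U <= 2 * V by rewrite /U /V /u /v; lra.
have V0 : 0 < V by lra.
have lV : 0 < ln V by apply: ln_gt0; lra.
have lU : 0 < ln U by apply: ln_gt0; lra.
have lUV : ln U <= 2 * ln V.
  have : ln U <= ln (2 * V) by rewrite ler_ln ?posrE; lra.
  rewrite lnM ?posrE//; have : ln 2 <= ln V by rewrite ler_ln ?posrE; lra.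
  by lra.
rewrite fE ?divr_gt0 ?leE// gE ?divr_gt0 ?leE// /F_small !lnE// -/(v k.+1) -/(u k.+1) -/V -/U.
have fg : (a / 2 ^+ k.+1) ^+ d.-1 * V `^ (- beta) * ln V `^ (- alpha) /
  ((b / 2 ^+ k.+1) ^+ d.-1 * U `^ (- (beta - 1)) * ln U `^ (- ga)) =
  (a / b) ^+ d.-1 * (V `^ (- beta) * U `^ (beta - 1)) * (ln V `^ (- alpha) * ln U `^ ga).
  have -> : a / b = (a / 2 ^+ k.+1) / (b / 2 ^+ k.+1) by field; rewrite !gt_eqF.
  set a' := a / 2 ^+ k.+1; have b'0 : 0 < b / 2 ^+ k.+1 by rewrite divr_gt0.
  set b' := b / 2 ^+ k.+1 in b'0 *; rewrite [(a' / b') ^+ _]expr_div_n (powRN U) (powRN (ln U)).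
  rewrite !invfM !invrK; set A := a' ^+ _; set B := (b' ^+ _)^-1.
  ring.
rewrite fg; apply: (@le_trans _ _ (K * (V^-1 * ((ln V)^-1 * ln V `^ (- e))))).
  have h1 : V `^ (- beta) * U `^ (beta - 1) <= 2 `^ (beta - 1) * V^-1.
    have -> : 2 `^ (beta - 1) * V^-1 = V `^ (- beta) * (2 * V) `^ (beta - 1).
      rewrite powRM ?(ltW V0)// mulrCA -powRD; last by rewrite (gt_eqF V0)/= implybT.
      by rewrite addrA addNr add0r powR_inv1 ?ltW.
    rewrite ler_wpM2l ?powR_ge0// ge0_ler_powR// ?nnegrE; lra.
  have h2 : ln V `^ (- alpha) * ln U `^ ga <= 2 `^ ga * ((ln V)^-1 * ln V `^ (- e)).
    have -> : 2 `^ ga * ((ln V)^-1 * ln V `^ (- e)) = ln V `^ (- alpha) * (2 * ln V) `^ ga.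
      rewrite powRM ?(ltW lV)// [RHS]mulrCA -powRD; last by rewrite (gt_eqF lV)/= implybT.
      have -> : - alpha + ga = -1 + - e by rewrite /ga; ring.
      rewrite [ln V `^ (_ - e)]powRD; last by rewrite (gt_eqF lV)/= implybT.
      by rewrite powR_inv1 ?(ltW lV).
    rewrite ler_wpM2l ?powR_ge0// ge0_ler_powR// ?nnegrE; lra.
  have -> : K * (V^-1 * ((ln V)^-1 * ln V `^ (- e))) = (a / b) ^+ d.-1 *
      ((2 `^ (beta - 1) * V^-1) * (2 `^ ga * ((ln V)^-1 * ln V `^ (- e)))).
    by rewrite /K; ring.
  rewrite -mulrA ler_wpM2l ?exprn_ge0 ?divr_ge0 ?(ltW a0) ?(ltW b0)//.
  by apply: ler_pM => //; rewrite mulr_ge0 ?powR_ge0.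
rewrite /h -mulrBr.
have v1 : 1 < v k by lra.
have vV : v k <= V by rewrite /V vS; lra.
have Vk : V - v k = ln 2 by rewrite /V vS (addrC (v k)) addrK.
have := ln_powR_incr e0 v1 vV; rewrite Vk => inc.
have -> : K * (V^-1 * ((ln V)^-1 * ln V `^ (- e))) =
    K / (e * ln 2) * (e * (ln 2 / (V * ln V)) * ln V `^ (- e)).
  by field; rewrite !gt_eqF.
apply: ler_wpM2l; first by rewrite divr_ge0// mulr_ge0// ltW.
exact: inc.
Qed.

(** * Potentials *)

Lemma nneseries_ge_term (R : realType) (t : nat -> \bar R) n :
  (forall k, 0 <= t k)%E -> (t n <= \sum_(0 <= k <oo) t k)%E.
Proof.
move=> t0; apply: le_trans (nneseries_lim_ge n.+1 _) => //.
by rewrite big_nat_recr//= leeDr// sume_ge0.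
Qed.

(** A pair with s_n <= |x - y| < s_(n-1) has kernel at most 1 / g(s_n). Balls replace annuli, which
    can only enlarge the sum; the term 0 covers the large distances. *)
Definition kernel_bound_term (R : realType) (d : nat) (g : R -> R) (s : nat -> R)
    (x : 'rV[R]_d) (n : nat) (y : borelRd R d) : R :=
  (g (s n))^-1 * \1_(if n is m.+1 then ball x (s m) else setT) y.

(* On the diagonal the kernel is [+oo], and so is the series, because
   [g (s n)] tends to [0]. *)
Lemma inv_kernel_le_series (R : realType) (d : nat) (g : R -> R) (s : nat -> R)
    (x y : 'rV[R]_d) :
  gauge_function g -> (forall n, 0 < s n) -> s n @[n --> \oo] --> 0 ->
  (inv_kernel g x y <=
   \sum_(0 <= n <oo) (kernel_bound_term g s x n y)%:E)%E.
Proof.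
move=> gg s0 cs; set t := fun n => (kernel_bound_term g s x n y)%:E.
have gs n : 0 < g (s n) by exact: gauge_gt0.
have t0 n : (0 <= t n)%E.
  by rewrite lee_fin mulr_ge0// invr_ge0 ltW.
have small (r : R) : 0 < r -> exists n, s n <= r.
  move=> r0; have := cs; move/cvgrPdist_le => /(_ r r0)/(@filter_ex _ \oo)[n].
  by rewrite sub0r normrN gtr0_norm// => sr; exists n.
have tE n : (if n is m.+1 then ball x (s m) y else True) -> t n = ((g (s n))^-1)%:E.
  by rewrite /t /kernel_bound_term indicE => h; rewrite mem_set ?mulr1//; case: n h.
rewrite /inv_kernel; case: eqP => [xy|/eqP xy].
  rewrite leye_eq; apply/eqP/eqyP => r r0.
  have r1 : 0 < r^-1 by rewrite invr_gt0.
  have := gauge_comp_cvg0 gg s0 cs; move/cvgrPdist_le => /(_ _ r1)/(@filter_ex _ \oo)[n].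
  rewrite sub0r normrN gtr0_norm// => sr.
  apply: le_trans (nneseries_ge_term n t0).
  rewrite tE; first by rewrite lee_fin -[r]invrK lef_pV2 ?posrE.
  by case: n sr => // m _; rewrite -xy; exact: ballxx.
have xy0 : 0 < `|x - y| by rewrite normr_gt0 subr_eq0.
(* For the least n with s_n <= |x - y|, minimality puts [y] in the ball of the preceding radius. *)
have exn := small _ xy0; have [n sn minn] := ex_minnP exn.
apply: le_trans (nneseries_ge_term n t0); rewrite tE.
  rewrite lee_fin lef_pV2 ?posrE ?gs//; last by apply: gauge_gt0 => //; rewrite enorm_gt0// subr_eq0.
  by apply: gauge_le => //; apply: le_trans sn (norm_le_enorm _).
case: n sn minn => // m _ minn; rewrite mx_norm_ball /ball_/= ltNge.
by apply/negP => /minn; rewrite ltnn.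
Qed.

(** Termwise integration pairs the mass of the ball of radius s_k with the kernel at s_(k+1), and
    the total mass with the kernel at s_0. *)
Lemma potential_le (R : realType) (d : nat) (g : R -> R) (s : nat -> R)
    (mu : {measure set (borelRd R d) -> \bar R}) (m : nat -> R) (B : R) (x : 'rV[R]_d) :
  gauge_function g -> (forall n, 0 < s n) -> s n @[n --> \oo] --> 0 ->
  mu setT = 1%E -> (forall n, (mu (ball x (s n)) <= (m n)%:E)%E) ->
  (forall n, (g (s 0))^-1 + \sum_(k < n) m k / g (s k.+1) <= B) ->
  (\int[mu]_y inv_kernel g x y <= B%:E)%E.
Proof.
move=> gg s0 cs mu1 mum mB.
have gs n : 0 < g (s n) by exact: gauge_gt0.
pose A n : set (borelRd R d) := if n is m.+1 then ball x (s m) else setT.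
have mA n : measurable (A n).
  by case: n => [|n] //=; apply: measurable_open_borelRd; exact: ball_open.
have t0 n y : (0 <= (kernel_bound_term g s x n y)%:E)%E.
  by rewrite lee_fin mulr_ge0// invr_ge0 ltW.
apply: (@le_trans _ _ (\int[mu]_y \sum_(0 <= n <oo) (kernel_bound_term g s x n y)%:E)%E).
  apply: ge0_le_integralT => y; first exact: inv_kernel_ge0.
  exact: inv_kernel_le_series.
rewrite integral_nneseries//; last first.
  move=> n; apply/measurable_EFinP; apply: measurable_funM => //.
  by apply: (@measurable_indic _ (borelRd R d) R setT (A n)); exact: mA.
apply: lime_le.
  by apply: is_cvg_nneseries => n _ _; apply: integral_ge0 => y _.
apply: nearW => n.
apply: (@le_trans _ _ (\sum_(0 <= k < n.+1) \int[mu]_y (kernel_bound_term g s x k y)%:E)%E).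
  by apply: lee_sum_nneg_natr => // k _ _; apply: integral_ge0 => y _.
apply: le_trans (_ : ((g (s 0))^-1 + \sum_(k < n) m k / g (s k.+1))%:E <= _)%E; last first.
  by rewrite lee_fin.
have intE k : (\int[mu]_y (kernel_bound_term g s x k y)%:E = (g (s k))^-1%:E * mu (A k))%E.
  by apply: (integral_cst_indic mu (mA k)); rewrite invr_ge0 ltW.
rewrite big_mkord big_ord_recl /= intE /= mu1 mule1 EFinD leeD2l// -sumEFin.
apply: lee_sum => k _; rewrite intE /= [m k / _]mulrC EFinM.
by rewrite lee_pmul2l ?lte_fin ?invr_gt0.
Qed.

(** * Lower bound for the capacity by the content *)

Lemma ediam_coord_le (R : realType) (d : nat) (E : set 'rV[R]_d) x y i :
  compact E -> E x -> E y -> `|x 0 i - y 0 i| <= ediam E.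
Proof.
move=> cE Ex Ey; have [M [_ /(_ (M + 1)) EM]] := compact_bounded cE.
have {}EM : forall z, E z -> `|z| <= M + 1 by apply: EM; rewrite ltrDl.
apply: le_trans (le_ediam_norm EM Ex Ey).
by have := coord_le_enorm (x - y) i; rewrite !mxE.
Qed.

(** The Frostman measure divided by its mass M is a probability measure whose potential is at most
    B/M everywhere, so its inverse energy is at least M/B. The constant B depends on [E] only
    through D. *)
Lemma hcontent_le_inv_capacity (R : realType) (d : nat) (alpha beta e D : R)
    (f g : R -> R) :
  (0 < d)%N -> 0 < e -> 1 <= beta -> 1 + e <= alpha ->
  gauge_extension d alpha beta f ->
  gauge_extension d (alpha - 1 - e) (beta - 1) g ->
  exists2 A : R, 0 < A & forall E : set 'rV[R]_d, compact E -> ediam E = D ->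
    (0 < hcontent f E)%E -> (A%:E * hcontent f E <= inv_capacity g E)%E.
Proof.
move=> d0 e0 be1 al1 fext gext; have [gf _ _] := fext; have [gg _ _] := gext.
(* A cube of this side, centred at any point of [E], contains [E] and leaves a margin for the strict
   upper inequality. *)
pose L := 2 * (`|D| + 1); have L0 : 0 < L by rewrite mulr_gt0// ltr_wpDl.
pose a := d%:R * (d.+1%:R * L + d.+1%:R * L).
have a0 : 0 < a by rewrite mulr_gt0 ?ltr0n// addr_gt0// mulr_gt0.
have b0 : 0 < L / 2 by rewrite divr_gt0.
have [P hP] := gauge_ratio_sums_bounded e0 be1 al1 a0 b0 fext gext.
have P0 : 0 <= P by have := hP 0%N; rewrite big_ord0.
pose s := grid_side L; have s0 n : 0 < s n by rewrite divr_gt0// exprn_gt0.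
have cs : s n @[n --> \oo] --> 0 by exact: grid_side_cvg0.
have gs n : 0 < g (s n) by exact: gauge_gt0.
(* The first term absorbs the kernel at the largest scale, since M <= f(a); the second bounds the
   sum over the smaller scales. *)
pose B := f a / g (s 0) + (5 ^ d)%:R * P.
have fa0 : 0 < f a by exact: gauge_gt0.
have B0 : 0 < B by rewrite ltr_pwDl ?divr_gt0// mulr_ge0.
exists B^-1; first by rewrite invr_gt0.
move=> E cE ED hE0; have clE : closed E by apply: compact_closed => //; exact: norm_hausdorff.
have [x1 x1L] : exists x1 : 'rV[R]_d, forall x i, E x -> 0 <= x 0 i - x1 0 i < L.
  have [[x0 Ex0]|nE] := pselect (E !=set0); last first.
    by exists 0 => x i Ex; exfalso; apply: nE; exists x.
  exists (x0 - const_mx (`|D| + 1)) => x i Ex; rewrite !mxE.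
  have := ediam_coord_le i cE Ex Ex0; rewrite ED ler_norml => /andP[l u].
  by have := ler_norm D => Dn; apply/andP; split; rewrite /L; lra.
have [mu [muT hEle muE mub]] := frostman_measure_exists d0 gf clE L0 x1L.
rewrite -/a in hEle.
have hfin : hcontent f E \is a fin_num.
  by rewrite ge0_fin_numE ?hcontent_ge0// (le_lt_trans hEle)// ltry.
pose M := fine (hcontent f E).
have hM : hcontent f E = M%:E by rewrite fineK.
have M0 : 0 < M by rewrite -lte_fin -hM.
have Mi0 : 0 <= M^-1 by rewrite invr_ge0 ltW.
pose nu : {measure set (borelRd R d) -> \bar R} := mscale (NngNum Mi0) mu.
have nuE A : nu A = (M^-1%:E * mu A)%E by [].
have nu1 : nu setT = 1%E by rewrite nuE muT hM -EFinM mulVf// gt_eqF.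
have nuEC : nu (~` E) = 0%E by rewrite nuE muE mule0.
have rad : radon_measure nu.
  by apply: (radon_of_compact_support _ cE nuEC); rewrite nu1 ltry.
have supp : measure_supp nu `<=` E.
  move=> x sx; apply: contrapT => Ex; have oE : open (~` E) by exact: closed_openC.
  by have := sx _ oE Ex; rewrite nuEC ltxx.
have nE : E <> set0.
  move=> E0; move: nuEC; rewrite E0 setC0 nu1 => /eqP.
  by rewrite onee_eq0.
have pot x : (\int[nu]_y inv_kernel g x y <= (B / M)%:E)%E.
  apply: (@potential_le _ _ _ s _ (fun n => M^-1 * ((5 ^ d)%:R * f (a / 2 ^+ n)))) => //.
    move=> n; rewrite nuE EFinM lee_pmul2l ?lte_fin ?invr_gt0//.
    have := mub x n.
    have -> : d%:R * (d.+1%:R * grid_side L n + d.+1%:R * grid_side L n) = a / 2 ^+ n.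
      by rewrite /a /grid_side; ring.
    exact.
  move=> n; rewrite /B mulrDl; apply: lerD.
    rewrite mulrAC -[X in X <= _]mul1r ler_wpM2r ?invr_ge0 ?(ltW (gs _))//.
    by rewrite ler_pdivlMr// mul1r -lee_fin -hM.
  rewrite (_ : \sum_(k < n) _ = M^-1 * ((5 ^ d)%:R * \sum_(k < n) f (a / 2 ^+ k) / g (L / 2 / 2 ^+ k))).
    by rewrite mulrC ler_wpM2r// ler_wpM2l.
  rewrite !mulr_sumr; apply: eq_bigr => k _.
  have -> : s k.+1 = L / 2 / 2 ^+ k by rewrite /s /grid_side exprS invfM mulrA.
  by rewrite !mulrA.
have BM0 : 0 < B / M by rewrite divr_gt0.
have en : (energy g nu <= (B / M)%:E)%E.
  apply: (@le_trans _ _ (\int[nu]_x (cst (B / M)%:E x))%E).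
    apply: ge0_le_integralT => x; last exact: pot.
    by apply: integral_ge0 => y _; exact: inv_kernel_ge0.
  by rewrite integral_cst// nu1 mule1.
have en0 : (0 <= energy g nu)%E.
  by apply: integral_ge0 => x _; apply: integral_ge0 => y _; exact: inv_kernel_ge0.
rewrite /inv_capacity; case: asboolP => // _.
apply: (@le_trans _ _ (energy g nu)^-1%E); last first.
  by apply: ereal_sup_ubound; exists nu.
rewrite hM -EFinM; move: en en0; case: (energy g nu) => [r| |] //.
(* An energy equal to 0 has inverse +oo, and the bound is then trivial. *)
rewrite !lee_fin inver => rB r0; case: eqP => [_|/eqP rn]; first exact: leey.
have {r0} rn : 0 < r by rewrite lt_neqAle eq_sym rn.
rewrite lee_fin -[B^-1 * M]invrK lef_pV2 ?posrE// ?invr_gt0 ?mulr_gt0 ?invr_gt0//.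
by rewrite invfM invrK.
Qed.

Theorem lemma5p14 (R : realType) (d : nat) (hd : (2 <= d)%N)
    (F : R -> R -> R -> R)
    (hF : forall alpha beta : R, 0 <= alpha -> 0 <= beta ->
            gauge_extension d alpha beta (F alpha beta)) :
  (forall (alpha beta : R) (E : set 'rV[R]_d),
     0 <= alpha -> 0 <= beta -> compact E ->
     (0 < inv_capacity (F alpha beta) E)%E ->
     (((2^-1)%:E * inv_capacity (F alpha beta) E
         <= hcontent (F alpha beta) E)
      /\ (0 < (2^-1)%:E * inv_capacity (F alpha beta) E))%E)
  /\
  (forall alpha beta epsilon : R,
     0 < epsilon -> 1 <= beta -> 1 + epsilon <= alpha ->
     forall D : R, exists2 A : R, 0 < A &
       forall E : set 'rV[R]_d, compact E -> ediam E = D ->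
         (0 < hcontent (F alpha beta) E)%E ->
         ((A%:E * hcontent (F alpha beta) E
             <= inv_capacity (F (alpha - 1 - epsilon)%R (beta - 1)%R) E)
          /\ (0 < A%:E * hcontent (F alpha beta) E))%E).
Proof.
have d0 : (0 < d)%N by exact: leq_trans hd.
split=> [alpha beta E al0 be0 cE cap0|alpha beta e e0 be1 al1 D].
  have [gf _ _] := hF _ _ al0 be0; split; last by rewrite mule_gt0.
  apply: le_trans (inv_capacity_le_hcontent d0 gf cE).
  (* The inequality already holds with constant 1, and 1/2 <= 1. *)
  by rewrite -[leRHS]mul1e lee_wpmul2r ?(ltW cap0)// lee_fin invf_le1// ler1n.
have al0 : 0 <= alpha by lra.
have be0 : 0 <= beta by lra.
have al'0 : 0 <= alpha - 1 - e by lra.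
have be'0 : 0 <= beta - 1 by lra.
have [A A0 hA] := hcontent_le_inv_capacity D d0 e0 be1 al1 (hF _ _ al0 be0) (hF _ _ al'0 be'0).
exists A => // E cE ED hE; split; first exact: hA.
by rewrite mule_gt0.
Qed.
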